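(* For every $\phi\in\mathbf{Q}[P]$, $$\zeta(\phi)=L_{\square\phi}(1/2).$$
   Context: **Shuffle algebra.** Let $\mathcal W$ be the set of all words in the letters $a,b$ (including the empty word $\emptyset$), and let $\mathcal H=\mathbf{Q}\mathcal W$ be the $\mathbf{Q}$-vector space with basis $\mathcal W$. The shuffle product $*$ is the bilinear product given on words $w=x_1\cdots x_n$, $w'=x_{n+1}\cdots x_{n+m}$ by the sum over all shuffles of $w$ and $w'$ (all interleavings of the two words, preserving the order of letters in each, counted with multiplicity). $(\mathcal H,* )$ is a commutative associative algebra with unit $\emptyset$. Let $\mathcal W^+$ be the set of words whose first letter is not $b$ (including $\emptyset$), $\mathcal W^{++}$ the set of words whose first letter is not $b$ and whose last letter is not $a$ (including $\emptyset$), $\mathcal H^+=\mathbf{Q}\mathcal W^+$, $\mathcal H^{++}=\mathbf{Q}\mathcal W^{++}$. These are subalgebras and $\mathcal H=\mathcal H^+[b]=\mathcal H^{++}[a,b]$ are polynomial algebras (for $*$). **Polylogarithms and polyzeta values.** A nonempty $w\in\mathcal W^+$ is uniquely $w=ab^{t_1}ab^{t_2}\cdots ab^{t_k}$ with $t_i\ge 0$; put $r_i=1+t_i$ and, for $|z|<1$, $L_w(z)=\sum_{0<n_1<\dots<n_k} n_1^{-r_1}\cdots n_k^{-r_k}z^{n_k}$; $L_\emptyset=1$. If $w\in\mathcal W^{++}$ is nonempty (so $r_k\ge 2$), $\zeta(w)=\sum_{0<n_1<\dots<n_k} n_1^{-r_1}\cdots n_k^{-r_k}$; $\zeta(\emptyset)=1$.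 Let $\Omega=\{|z|<1\}\setminus\,]-1,0]$ and $\log z$ the holomorphic logarithm on $\Omega$ real on $]0,1[$. For $h\in\mathcal H$, $L_h(z)$ is the image of $h$ under the unique algebra morphism $(\mathcal H,* )\to \mathrm{Hol}(\Omega)$ sending $w\in\mathcal W^+$ to $L_w(z)$ and $b$ to $\log z$. For $h\in\mathcal H$, $\zeta(h)$ is the image of $h$ under the unique algebra morphism $(\mathcal H,* )\to\mathbf{C}$ sending $w\in\mathcal W^{++}$ to $\zeta(w)$ and $a,b$ to $0$. **The group $\Gamma$.** Let $F$ be the free Lie algebra over $\mathbf{Q}$ on generators $\alpha,\beta$, $C^nF$ its descending central series, $\mathfrak g=\varprojlim F/C^nF$, and $\Gamma=\varprojlim\Gamma_n$ the pro-algebraic (pro-unipotent) group over $\mathbf{Q}$, where $\Gamma_n$ is $F/C^nF$ with the Campbell–Hausdorff group law; $\exp:\mathfrak g\to\Gamma$ is the resulting isomorphism of pro-algebraic varieties. $\mathcal H$ is a Hopf algebra with product $*$ and coproduct $\Delta(c_1\cdots c_n)=\sum_{0\le i\le n}c_1\cdots c_i\otimes c_{i+1}\cdots c_n$, and $\mathbf{Q}[\Gamma]$ is identified with $\mathcal H$ via the group isomorphism $\Gamma\simeq\mathrm{Spec}\,\mathcal H$ such that, for $t\in\mathbf{Q}$ and a word $w$: $w(\exp t\alpha)=t^n/n!$ if $w=a^n$ and $0$ if $b$ occurs in $w$; $w(\exp t\beta)=t^n/n!$ if $w=b^n$ and $0$ if $a$ occurs in $w$. Thus $L_\Phi(z)$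 and $\zeta(\Phi)$ are defined for $\Phi\in\mathbf{Q}[\Gamma]$. **The symmetric space $P$.** Let $\sigma$ be the anti-automorphism of $\Gamma$ with $\sigma(\exp t\alpha)=\exp t\beta$, $\sigma(\exp t\beta)=\exp t\alpha$ for all $t$. Let $K=\{g\in\Gamma\mid\sigma(g)=g^{-1}\}$ (a subgroup) and $P=\{g\in\Gamma\mid \sigma(g)=g\}$ (a closed subvariety). Every $g\in\Gamma$ is uniquely $g=pk$ with $p\in P$, $k\in K$, so $P\simeq\Gamma/K$. For $\phi\in\mathbf{Q}[P]$: $\zeta(\phi):=\zeta(\hat\phi)$ for any $\hat\phi\in\mathbf{Q}[\Gamma]$ extending $\phi$ (this does not depend on the choice); $L_\phi(z):=L_\Phi(z)$, where $\Phi\in\mathbf{Q}[\Gamma]$ is the unique right $K$-invariant extension of $\phi$, $\Phi(pk)=\phi(p)$; and $\square\phi\in\mathbf{Q}[P]$ is defined by $\square\phi(p)=\phi(p^2)$. *)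

(* Defs.v *)
From HB Require Import structures.
From mathcomp Require Import all_boot all_order all_algebra.
From mathcomp Require Import finmap complex.
From mathcomp Require Import all_classical all_reals all_analysis.
From mathcomp Require monalg.
Import Order.TTheory GRing.Theory Num.Theory.
Import numFieldNormedType.Exports.

Set Implicit Arguments.
Unset Strict Implicit.
Unset Printing Implicit Defensive.

Local Open Scope ring_scope.

(* Words in two letters a, b; exchanging the letters is [negb].              *)
Notation letter := bool (only parsing).
Notation la := false (only parsing).
Notation lb := true (only parsing).
Definition word := seq letter.

(* All interleavings of u and v, listed with multiplicity.                   *)
Fixpoint shuffle (u v : word) {struct u} : seq word :=
  match u with
  | [::] => [:: v]
  | x :: u' =>
      (fix shuffle_u (v : word) : seq word :=
         match v with
         | [::] => [:: u]
         | y :: v' => map (cons x) (shuffle u' v) ++ map (cons y) (shuffle_u v')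
         end) v
  end.

Section ShuffleTheory.
Variable V : nmodType.
Implicit Types (u v w : word) (F : word -> V).

Let S F u v := \sum_(w <- shuffle u v) F w.

Let S0 F v : S F [::] v = F v.
Proof. by rewrite /S /= big_seq1. Qed.

Let S0r F u : S F u [::] = F u.
Proof. by rewrite /S; case: u => [|x u] /=; rewrite big_seq1. Qed.

Let SS F x u y v : S F (x :: u) (y :: v) =
  S (fun w => F (x :: w)) u (y :: v) + S (fun w => F (y :: w)) (x :: u) v.
Proof. by rewrite /S /= big_cat !big_map. Qed.

Lemma shuffle_sumC F u v :
  \sum_(w <- shuffle u v) F w = \sum_(w <- shuffle v u) F w.
Proof.
rewrite -!/(S _ _ _); elim: u v F => [|x u IHu] v F; first by rewrite S0 S0r.
elim: v F => [|y v IHv] F; first by rewrite S0 S0r.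
by rewrite !SS addrC IHu IHv.
Qed.

Lemma shuffle_sumA F u v s :
  \sum_(w <- shuffle u v) \sum_(t <- shuffle w s) F t =
  \sum_(w <- shuffle v s) \sum_(t <- shuffle u w) F t.
Proof.
suff H F' u' v' s' : S (fun w => S F' w s') u' v' = S (fun w => S F' u' w) v' s'
  by exact: H.
elim: u' v' s' F' => [|x u' IHu] v' s' F'.
  by rewrite S0; apply: eq_bigr => w _; rewrite S0.
elim: v' s' F' => [|y v' IHv] s' F'; first by rewrite S0r S0.
elim: s' F' => [|z s' IHs] F'.
  by rewrite S0r; apply: eq_bigr => w _; rewrite S0r.
have SD F1 F2 p q : S (fun w => F1 w + F2 w) p q = S F1 p q + S F2 p q.
  by rewrite /S big_split.
have eS F1 F2 p q : F1 =1 F2 -> S F1 p q = S F2 p q.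
  by move=> E; apply: eq_bigr.
rewrite SS (eS _ _ u' _ (fun w => SS F' x w z s')) SD IHu SS.
rewrite (eS _ _ _ v' (fun w => SS F' y w z s')) SD IHv.
rewrite [RHS]SS (eS _ _ v' _ (fun w => SS F' x u' y w)) SD.
rewrite (eS _ _ _ s' (fun w => SS F' x u' z w)) SD -IHs [in RHS]SS.
rewrite -!addrA; congr (_ + _); rewrite [RHS]addrCA.
by congr (_ + _); rewrite addrCA.
Qed.

Lemma shuffle_sum_map (f : letter -> letter) F u v :
  \sum_(w <- shuffle (map f u) (map f v)) F w =
  \sum_(w <- shuffle u v) F (map f w).
Proof.
rewrite -!/(S _ _ _); elim: u v F => [|x u IHu] v F; first by rewrite !S0.
elim: v F => [|y v IHv] F; first by rewrite !S0r.
by rewrite /= !SS -!map_cons IHu IHv.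
Qed.

Let SSr F x u y v : S F (rcons u x) (rcons v y) =
  S (fun w => F (rcons w x)) u (rcons v y) +
  S (fun w => F (rcons w y)) (rcons u x) v.
Proof.
elim: u v F => [|x' u IHu] v F; elim: v F => [|y' v IHv] F.
- by rewrite /= SS !S0 !S0r addrC.
- by rewrite rcons_cons SS !S0 IHv SS !S0 addrCA.
- rewrite [rcons [::] y]/= rcons_cons SS -[ [:: y] ]/(rcons [::] y) (IHu [::]).
  by rewrite [rcons [::] y]/= SS !S0r -!addrA; congr (_ + _); rewrite addrC.
rewrite rcons_cons [rcons (y' :: v) y]rcons_cons SS -rcons_cons (IHu (y' :: v)).
rewrite -[x' :: rcons u x]rcons_cons IHv.
rewrite [rcons (y' :: v) y]rcons_cons [rcons (x' :: u) x]rcons_cons.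
by rewrite ![in RHS]SS addrACA.
Qed.

Lemma shuffle_sum_rev F u v :
  \sum_(w <- shuffle (rev u) (rev v)) F w =
  \sum_(w <- shuffle u v) F (rev w).
Proof.
rewrite -!/(S _ _ _); elim: u v F => [|x u IHu] v F; first by rewrite !S0.
elim: v F => [|y v IHv] F; first by rewrite !S0r.
rewrite !rev_cons SSr SS -rev_cons IHu -rev_cons IHv.
by congr (_ + _); apply: eq_bigr => w _; rewrite rev_cons.
Qed.

(* The sum over all ways of cutting w into a prefix and a suffix.            *)
Definition deconcat (F : word -> word -> V) w : V :=
  \sum_(i < (size w).+1) F (take i w) (drop i w).

Lemma deconcat_nil (F : word -> word -> V) : deconcat F [::] = F [::] [::].
Proof. by rewrite /deconcat big_ord1. Qed.

Lemma deconcat_cons (F : word -> word -> V) x w : deconcat F (x :: w) =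
  F [::] (x :: w) + deconcat (fun p q => F (x :: p) q) w.
Proof. by rewrite /deconcat big_ord_recl. Qed.

Lemma eq_deconcat (F1 F2 : word -> word -> V) w :
  (forall p q, F1 p q = F2 p q) -> deconcat F1 w = deconcat F2 w.
Proof. by move=> E; apply: eq_bigr. Qed.

Lemma deconcatD (F1 F2 : word -> word -> V) w :
  deconcat (fun p q => F1 p q + F2 p q) w = deconcat F1 w + deconcat F2 w.
Proof. by rewrite /deconcat big_split. Qed.

Lemma deconcatA (F : word -> word -> word -> V) w :
  deconcat (fun p s => deconcat (fun q r => F q r s) p) w =
  deconcat (fun q t => deconcat (F q) t) w.
Proof.
elim: w F => [|x w IHw] F; first by rewrite !deconcat_nil.
rewrite !deconcat_cons deconcat_nil -addrA -IHw -deconcatD.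
by congr (_ + _); apply: eq_deconcat => p s; rewrite deconcat_cons.
Qed.

Lemma deconcat_rev (F : word -> word -> V) w :
  deconcat F (rev w) = deconcat (fun p q => F (rev q) (rev p)) w.
Proof.
rewrite /deconcat size_rev (reindex_inj rev_ord_inj) /=; apply: eq_bigr => i _.
by rewrite take_rev drop_rev !subSS subKn // -ltnS.
Qed.

Lemma deconcat_map (f : letter -> letter) (F : word -> word -> V) w :
  deconcat F (map f w) = deconcat (fun p q => F (map f p) (map f q)) w.
Proof.
rewrite /deconcat size_map; apply: eq_bigr => i _.
by rewrite map_take map_drop.
Qed.

Lemma shuffle_sum_deconcat (F : word -> word -> V) u v :
  \sum_(w <- shuffle u v) deconcat F w =
  deconcat (fun u1 u2 => deconcat (fun v1 v2 =>
    \sum_(w1 <- shuffle u1 v1) \sum_(w2 <- shuffle u2 v2) F w1 w2) v) u.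
Proof.
have SD F1 F2 p q : S (fun w => F1 w + F2 w) p q = S F1 p q + S F2 p q.
  by rewrite /S big_split.
have eS F1 F2 p q : F1 =1 F2 -> S F1 p q = S F2 p q.
  by move=> E; apply: eq_bigr.
pose T (G : word -> word -> V) p1 p2 q1 q2 := S (fun w => S (G w) p2 q2) p1 q1.
suff H G p q :
    S (deconcat G) p q = deconcat (fun p1 p2 => deconcat (T G p1 p2) q) p.
  exact: H.
elim: p q G => [|x p IHp] q G.
  by rewrite S0 deconcat_nil; apply: eq_deconcat => q1 q2; rewrite /T !S0.
elim: q G => [|y q IHq] G.
  by rewrite S0r; apply: eq_deconcat => p1 p2; rewrite deconcat_nil /T !S0r.
pose Gx p1 p2 := G (x :: p1) p2; pose Gy p1 p2 := G (y :: p1) p2.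
have -> : S (deconcat G) (x :: p) (y :: q) =
    S (G [::]) (x :: p) (y :: q) +
    (S (deconcat Gx) p (y :: q) + S (deconcat Gy) (x :: p) q).
  rewrite !SS (eS _ _ p _ (fun w => deconcat_cons G x w)).
  rewrite (eS _ _ _ q (fun w => deconcat_cons G y w)).
  by rewrite !SD addrACA.
rewrite IHp IHq [in LHS]deconcat_cons.
rewrite [in RHS]deconcat_cons [in RHS]deconcat_cons.
have -> : T G [::] (x :: p) [::] (y :: q) = S (G [::]) (x :: p) (y :: q).
  by rewrite /T S0.
rewrite -addrA; congr (_ + _).
rewrite addrCA; congr (_ + _).
  by apply: eq_deconcat => q1 q2; rewrite /T !S0.
rewrite -deconcatD; apply: eq_deconcat => p1 p2.
rewrite !deconcat_cons -addrA -deconcatD.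
congr (_ + _); first by rewrite /T !S0r.
by apply: eq_deconcat => q1 q2; rewrite /T SS.
Qed.

End ShuffleTheory.


(* The Q-vector space with basis the words, as a type of its own since its   *)
(* product is the shuffle product and not a monoid algebra product.          *)
Definition shalg := monalg.malg word rat.
HB.instance Definition _ := GRing.Lmodule.copy shalg
  (monalg.monalg_malg__canonical__GRing_Lmodule word rat).

Definition wd (w : word) : shalg := monalg.mkmalgU w 1.

(* Linear extension of a map defined on words.                               *)
Definition lin (V : lmodType rat) (f : word -> V) (h : shalg) : V :=
  \sum_(w <- monalg.msupp h) monalg.mcoeff w h *: f w.

Section Lin.
Variable V : lmodType rat.
Implicit Types (f : word -> V) (h : shalg).

Lemma linEw f h (d : {fset word}) : (monalg.msupp h `<=` d)%fset ->
  lin f h = \sum_(w <- d) monalg.mcoeff w h *: f w.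
Proof.
move=> sub; rewrite /lin (big_fset_incl _ sub) // => w _.
by rewrite -monalg.mcoeff_eq0 => /eqP ->; rewrite scale0r.
Qed.

Fact lin_is_linear f : linear (lin f).
Proof.
move=> c h k; set l : shalg := c *: h + k.
pose d := (monalg.msupp h `|` (monalg.msupp k `|` monalg.msupp l))%fset.
have sh : (monalg.msupp h `<=` d)%fset by rewrite fsubsetUl.
have sk : (monalg.msupp k `<=` d)%fset by rewrite /d fsetUCA fsubsetUl.
have sl : (monalg.msupp l `<=` d)%fset by rewrite /d fsetUA fsubsetUr.
rewrite (linEw _ sl) (linEw _ sk) (linEw _ sh).
rewrite scaler_sumr -big_split; apply: eq_bigr => w _ /=.
by rewrite monalg.mcoeffD monalg.mcoeffZ scalerDl scalerA.
Qed.

HB.instance Definition _ f :=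
  GRing.isLinear.Build rat shalg V _ (lin f) (lin_is_linear f).

Lemma lin_wd f w : lin f (wd w) = f w.
Proof.
rewrite (@linEw _ _ [fset w]%fset); last exact: monalg.msuppU_le.
by rewrite big_seq_fset1 monalg.mcoeffUU scale1r.
Qed.

Lemma shalgE h : h = \sum_(w <- monalg.msupp h) monalg.mcoeff w h *: wd w.
Proof.
rewrite {1}[h]monalg.monalgE; apply: eq_bigr => w _.
apply/monalg.malgP => k.
by rewrite monalg.mcoeffZ !monalg.mcoeffU mulrnAr mulr1.
Qed.

Lemma lin_map (g : shalg -> V) :
  linear g -> forall h, g h = lin (fun w => g (wd w)) h.
Proof.
move=> gL h.
pose g' : {linear shalg -> V} := HB.pack g
  (GRing.isLinear.Build rat shalg V _ g gL).
rewrite -[LHS]/(g' h) {1}(shalgE h) linear_sum.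
by apply: eq_bigr => w _; rewrite linearZ.
Qed.

Lemma shalg_ext (g1 g2 : shalg -> V) : linear g1 -> linear g2 ->
  (forall w, g1 (wd w) = g2 (wd w)) -> forall h, g1 h = g2 h.
Proof.
move=> L1 L2 E h; rewrite (lin_map L1) (lin_map L2) /lin.
by apply: eq_bigr => w _; rewrite E.
Qed.

Lemma lin_fun_linear (f : shalg -> word -> V) :
  (forall w, linear (f^~ w)) -> forall h, linear (fun k => lin (f k) h).
Proof.
move=> fL h c k1 k2; rewrite /lin scaler_sumr -big_split.
by apply: eq_bigr => w _; rewrite /= fL scalerDr !scalerA mulrC.
Qed.

End Lin.

Definition shalg_one : shalg := wd [::].

Definition shalg_mul (h k : shalg) : shalg :=
  lin (fun u => lin (fun v => \sum_(w <- shuffle u v) wd w) k) h.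

Fact shalg_mulwd u v : shalg_mul (wd u) (wd v) = \sum_(w <- shuffle u v) wd w.
Proof. by rewrite /shalg_mul !lin_wd. Qed.

Fact shalg_mull_linear k : linear (shalg_mul^~ k).
Proof. exact: lin_is_linear. Qed.

Fact shalg_mulr_linear h : linear (shalg_mul h).
Proof.
by apply: (lin_fun_linear (f := fun k u => lin _ k)) => w; apply: lin_is_linear.
Qed.

Fact linear_comp_rat (U V W : lmodType rat) (f : V -> W) (g : U -> V) :
  linear f -> linear g -> linear (fun x => f (g x)).
Proof. by move=> fL gL c x y; rewrite gL fL. Qed.

Fact linear_sum_rat (U V : lmodType rat) (g : U -> V) (I : Type) (s : seq I) F :
  linear g -> g (\sum_(i <- s) F i) = \sum_(i <- s) g (F i).
Proof.
move=> gL.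
pose g' : {linear U -> V} := HB.pack g (GRing.isLinear.Build rat U V _ g gL).
by rewrite -[LHS]/(g' _) linear_sum.
Qed.

Fact shalg_mulC : commutative shalg_mul.
Proof.
move=> h k; move: h.
apply: shalg_ext => [||u];
  [exact: shalg_mull_linear | exact: shalg_mulr_linear |].
move: k; apply: shalg_ext => [||v];
  [exact: shalg_mulr_linear | exact: shalg_mull_linear |].
by rewrite !shalg_mulwd shuffle_sumC.
Qed.

Fact shalg_mulA : associative shalg_mul.
Proof.
have ml := shalg_mull_linear; have mr := shalg_mulr_linear.
move=> h k l; move: h; apply: shalg_ext => [||u].
- exact: ml.
- exact: (linear_comp_rat (ml l) (ml k)).
move: k; apply: shalg_ext => [||v].
- exact: (linear_comp_rat (mr (wd u)) (ml l)).
- exact: (linear_comp_rat (ml l) (mr (wd u))).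
move: l; apply: shalg_ext => [||s].
- exact: (linear_comp_rat (mr (wd u)) (mr (wd v))).
- exact: mr.
rewrite !shalg_mulwd (linear_sum_rat _ _ (mr _)).
rewrite (linear_sum_rat _ _ (ml (wd s))).
rewrite (eq_bigr _ (fun i _ => shalg_mulwd u i)).
rewrite [RHS](eq_bigr _ (fun i _ => shalg_mulwd i s)).
by rewrite shuffle_sumA.
Qed.

Fact shalg_mul1 : left_id shalg_one shalg_mul.
Proof.
apply: shalg_ext => [||u]; [exact: shalg_mulr_linear | by [] |].
by rewrite shalg_mulwd big_seq1.
Qed.

Fact shalg_mulDl : left_distributive shalg_mul +%R.
Proof.
by move=> h k l; have := shalg_mull_linear l 1 h k; rewrite !scale1r.
Qed.

Fact shalg_one_neq0 : shalg_one != 0.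
Proof.
apply/eqP => /(congr1 (@monalg.mcoeff word rat [::])).
by rewrite monalg.mcoeffUU monalg.mcoeff0.
Qed.

HB.instance Definition _ := GRing.Zmodule_isComNzRing.Build shalg
  shalg_mulA shalg_mulC shalg_mul1 shalg_mulDl shalg_one_neq0.

Fact shalg_scaleAl (c : rat) (h k : shalg) : c *: (h * k) = (c *: h) * k.
Proof.
have := shalg_mull_linear k c h 0.
by rewrite -[shalg_mul 0 k]/(0 * k) mul0r !addr0.
Qed.

HB.instance Definition _ :=
  GRing.Lmodule_isLalgebra.Build rat shalg shalg_scaleAl.
HB.instance Definition _ := GRing.Lalgebra_isComAlgebra.Build rat shalg.

Lemma wdM u v : wd u * wd v = \sum_(w <- shuffle u v) wd w.
Proof. exact: shalg_mulwd. Qed.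

Lemma wd_nil : wd [::] = 1.
Proof. by []. Qed.

(* A linear map that is multiplicative on words is an algebra morphism.      *)
Lemma lin_monoid_morphism (A : comAlgType rat) (f : word -> A) :
  f [::] = 1 ->
  (forall u v, \sum_(w <- shuffle u v) f w = f u * f v) ->
  monoid_morphism (lin f).
Proof.
move=> f1 fM; split=> [|h k]; first by rewrite -wd_nil lin_wd.
have fL := @lin_is_linear _ f.
have ml := shalg_mull_linear; have mr := shalg_mulr_linear.
have al (x : A) : linear (fun y => y * x).
  by move=> c y z; rewrite mulrDl scalerAl.
have ar (x : A) : linear (fun y => x * y).
  by move=> c y z; rewrite mulrDr scalerAr.
move: h; apply: shalg_ext => [||u].
- exact: (linear_comp_rat fL (ml k)).
- exact: (linear_comp_rat (al _) fL).
move: k; apply: shalg_ext => [||v].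
- exact: (linear_comp_rat fL (mr (wd u))).
- exact: (linear_comp_rat (ar _) fL).
rewrite wdM (linear_sum_rat _ _ fL) !lin_wd -fM.
by apply: eq_bigr => w _; rewrite lin_wd.
Qed.

(* The A-points of Gamma = Spec H are the Q-algebra morphisms H -> A.        *)
Definition Gamma (A : comAlgType rat) := {lrmorphism shalg -> A}.

HB.instance Definition _ A := gen_eqMixin (Gamma A).
HB.instance Definition _ A := gen_choiceMixin (Gamma A).

Lemma Gamma_ext (A : comAlgType rat) (g h : Gamma A) :
  (forall w, g (wd w) = h (wd w)) -> g = h.
Proof.
move=> E; have {}E : (g : shalg -> A) = h.
  by apply/funext; apply: shalg_ext => //; exact: linearP.
case: g h E => [g [[m1] [m2] [m3]]] [h [[n1] [n2] [n3]]] /= E.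
case: _ / E n1 n2 n3 => n1 n2 n3.
by rewrite (Prop_irrelevance m1 n1) (Prop_irrelevance m2 n2)
           (Prop_irrelevance m3 n3).
Qed.

(* A map on words that is multiplicative for the shuffle defines a point.    *)
Definition mkGamma (A : comAlgType rat) (f : word -> A) (f1 : f [::] = 1)
    (fM : forall u v, \sum_(w <- shuffle u v) f w = f u * f v) : Gamma A :=
  HB.pack (lin f) (GRing.isMonoidMorphism.Build shalg A (lin f)
                     (lin_monoid_morphism f1 fM)).

Section GammaGroup.
Variable A : comAlgType rat.
Implicit Types g h k : Gamma A.

Lemma mkGammaE (f : word -> A) f1 fM w : @mkGamma A f f1 fM (wd w) = f w.
Proof. exact: lin_wd. Qed.

Fact Gamma_mul1 g h :
  deconcat (fun u v => g (wd u) * h (wd v)) [::] = 1.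
Proof. by rewrite deconcat_nil !wd_nil !rmorph1 mulr1. Qed.

Fact Gamma_mulM g h u v :
  \sum_(w <- shuffle u v) deconcat (fun u v => g (wd u) * h (wd v)) w =
  deconcat (fun u v => g (wd u) * h (wd v)) u *
  deconcat (fun u v => g (wd u) * h (wd v)) v.
Proof.
rewrite shuffle_sum_deconcat /deconcat big_distrlr; apply: eq_bigr => i _.
apply: eq_bigr => j _ /=; rewrite mulrACA -!rmorphM !wdM !raddf_sum big_distrlr.
by [].
Qed.

(* The group law dual to the deconcatenation coproduct of H.                 *)
Definition Gamma_mul g h : Gamma A := mkGamma (Gamma_mul1 g h) (Gamma_mulM g h).

Fact Gamma_one1 : ([::] == [::] :> word)%:R = 1 :> A. Proof. by []. Qed.

Fact Gamma_oneM (u v : word) :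
  \sum_(w <- shuffle u v) (w == [::])%:R = (u == [::])%:R * (v == [::])%:R :> A.
Proof.
case: u v => [|x u] [|y v]; rewrite ?mul0r ?mul1r /= ?big_seq1 //.
by rewrite big_cat !big_map /= !big1 // addr0.
Qed.

Definition Gamma_one : Gamma A := mkGamma Gamma_one1 Gamma_oneM.

Fact shuffle_size (u v w : word) :
  w \in shuffle u v -> size w = (size u + size v)%N.
Proof.
elim: u v w => [|x u IHu] v w; first by rewrite inE => /eqP ->.
elim: v w => [|y v IHv] w; first by rewrite inE => /eqP ->; rewrite addn0.
rewrite /= mem_cat => /orP[] /mapP[w' w'in ->] /=.
  by rewrite (IHu _ _ w'in) /= addSn.
by rewrite (IHv _ w'in) /= addnS.
Qed.

Fact Gamma_inv1 g : (-1) ^+ size ([::] : word) *: g (wd (rev [::])) = 1.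
Proof. by rewrite scale1r wd_nil rmorph1. Qed.

Fact Gamma_invM g (u v : word) :
  \sum_(w <- shuffle u v) (-1) ^+ size w *: g (wd (rev w)) =
  ((-1) ^+ size u *: g (wd (rev u))) * ((-1) ^+ size v *: g (wd (rev v))).
Proof.
rewrite -scalerAl -scalerAr scalerA -exprD -rmorphM wdM raddf_sum /=.
rewrite (shuffle_sum_rev (fun w => g (wd w))) scaler_sumr !big_seq.
by apply: eq_bigr => w /shuffle_size ->.
Qed.

(* Composition with the antipode w |-> (-1)^|w| rev w of H.                  *)
Definition Gamma_inv g : Gamma A := mkGamma (Gamma_inv1 g) (Gamma_invM g).

Fact Gamma_mulA : associative Gamma_mul.
Proof.
move=> g h k; apply: Gamma_ext => w; rewrite !mkGammaE.
transitivity (deconcat (fun p t => deconcat (fun q r =>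
    g (wd p) * (h (wd q) * k (wd r))) t) w).
  apply: eq_deconcat => p t; rewrite mkGammaE /deconcat mulr_sumr.
  by apply: eq_bigr.
rewrite -deconcatA; apply: eq_deconcat => p t.
rewrite mkGammaE /deconcat mulr_suml.
by apply: eq_bigr => i _; rewrite mulrA.
Qed.

Fact Gamma_mul1g : left_id Gamma_one Gamma_mul.
Proof.
move=> g; apply: Gamma_ext => -[|x w]; rewrite mkGammaE.
  by rewrite deconcat_nil mkGammaE mul1r.
rewrite deconcat_cons mkGammaE mul1r.
by rewrite /deconcat big1 ?addr0 // => i _; rewrite mkGammaE mul0r.
Qed.

Fact Gamma_mulg1 : right_id Gamma_one Gamma_mul.
Proof.
move=> g; apply: Gamma_ext => w; rewrite mkGammaE /deconcat big_ord_recr /=.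
rewrite drop_size take_size lin_wd mulr1.
rewrite big1 ?add0r // => i _; rewrite lin_wd.
by rewrite -size_eq0 size_drop subn_eq0 leqNgt ltn_ord mulr0.
Qed.

Let pre (x : letter) : shalg -> shalg := lin (fun w => wd (x :: w)).

Let antipode_aux y p w :
  deconcat (fun q r => (-1) ^+ size q *: (wd (catrev q (y :: p)) * wd r)) w =
  pre y (wd p * wd w).
Proof.
have pL z := @lin_is_linear shalg (fun w => wd (z :: w)).
have preE z u v : pre z (wd u * wd v) = \sum_(w <- shuffle u v) wd (z :: w).
  rewrite /pre wdM (linear_sum_rat _ _ (pL z)).
  by apply: eq_bigr => *; exact: lin_wd.
elim: w y p => [|x w IHw] y p.
  by rewrite deconcat_nil scale1r /= wd_nil !mulr1 /pre lin_wd.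
rewrite deconcat_cons scale1r /=.
have -> : deconcat (fun q r =>
    (-1) ^+ (size q).+1 *: (wd (catrev q [:: x, y & p]) * wd r)) w =
    - deconcat (fun q r =>
        (-1) ^+ size q *: (wd (catrev q [:: x, y & p]) * wd r)) w.
  rewrite /deconcat -sumrN; apply: eq_bigr => i _.
  by rewrite exprS mulN1r scaleNr.
rewrite IHw !preE wdM /= big_cat !big_map /= addrK.
by [].
Qed.

Let antipode_sum (w : word) :
  deconcat (fun q r => (-1) ^+ size q *: (wd (rev q) * wd r)) w =
  (w == [::])%:R.
Proof.
case: w => [|x w].
  by rewrite deconcat_nil scale1r !wd_nil mulr1.
rewrite deconcat_cons scale1r wd_nil mul1r.
have -> : deconcat (fun q r =>
    (-1) ^+ size (x :: q) *: (wd (rev (x :: q)) * wd r)) w =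
    - deconcat (fun q r =>
        (-1) ^+ size q *: (wd (catrev q [:: x]) * wd r)) w.
  rewrite /deconcat -sumrN; apply: eq_bigr => i _.
  by rewrite /= exprS mulN1r scaleNr.
by rewrite antipode_aux wd_nil mul1r /pre lin_wd subrr.
Qed.

Fact Gamma_mulVg : left_inverse Gamma_one Gamma_inv Gamma_mul.
Proof.
move=> g; apply: Gamma_ext => w; rewrite !mkGammaE.
transitivity (g ((w == [::])%:R)); last by rewrite rmorph_nat.
rewrite -antipode_sum /deconcat linear_sum; apply: eq_bigr => i _.
by rewrite mkGammaE linearZZ rmorphM -scalerAl.
Qed.

Fact Gamma_mulgV : right_inverse Gamma_one Gamma_inv Gamma_mul.
Proof.
move=> g; rewrite -[X in Gamma_mul X _](_ : Gamma_inv (Gamma_inv g) = g).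
  exact: Gamma_mulVg.
apply: Gamma_ext => w; rewrite !mkGammaE size_rev revK scalerA -exprD addnn.
by rewrite -signr_odd odd_double scale1r.
Qed.

HB.instance Definition _ := isGroup.Build (Gamma A)
  Gamma_mulA Gamma_mul1g Gamma_mulg1 Gamma_mulVg Gamma_mulgV.

Lemma Gamma_mulE g h w :
  (g * h)%g (wd w) =
  \sum_(i < (size w).+1) g (wd (take i w)) * h (wd (drop i w)).
Proof. exact: mkGammaE. Qed.

End GammaGroup.

Section OneParameter.
Variables (A : comAlgType rat) (x : letter) (t : A).

Let f (w : word) : A :=
  if w == nseq (size w) x then (size w)`!%:R^-1 *: t ^+ size w else 0.

Fact shuffle_all (p : pred letter) (u v w : word) :
  w \in shuffle u v -> all p w = all p u && all p v.
Proof.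
elim: u v w => [|y u IHu] v w; first by rewrite inE => /eqP ->.
elim: v w => [|z v IHv] w; first by rewrite inE => /eqP ->; rewrite andbT.
rewrite /= mem_cat => /orP[] /mapP[w' w'in ->] /=.
  by rewrite (IHu _ _ w'in) /= -andbA.
by rewrite (IHv _ w'in) /= andbCA.
Qed.

Fact size_shuffle (u v : word) :
  size (shuffle u v) = 'C(size u + size v, size u).
Proof.
elim: u v => [|y u IHu] v; first by rewrite bin0.
elim: v => [|z v IHv]; first by rewrite addn0 binn.
rewrite -[shuffle _ _]/(map (cons y) (shuffle u (z :: v)) ++
                         map (cons z) (shuffle (y :: u) v)).
by rewrite size_cat !size_map IHu IHv /= !addSn addnS binS addnC.
Qed.

Fact exp_point1 : f [::] = 1.
Proof. by rewrite /f /= fact0 invr1 scale1r. Qed.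

Fact exp_pointM u v : \sum_(w <- shuffle u v) f w = f u * f v.
Proof.
have fE w : f w =
    if all (pred1 x) w then (size w)`!%:R^-1 *: t ^+ size w else 0.
  rewrite /f; congr (if _ then _ else _); apply/eqP/all_pred1P => //.
under eq_bigr do rewrite fE; rewrite !fE.
pose n := (size u + size v)%N.
have -> : \sum_(w <- shuffle u v) (if all (pred1 x) w
      then (size w)`!%:R^-1 *: t ^+ size w else 0) =
    (if all (pred1 x) u && all (pred1 x) v then n`!%:R^-1 *: t ^+ n else 0)
      *+ size (shuffle u v).
  rewrite -iter_addr_0 -count_predT -big_const_seq !big_seq.
  by apply: eq_bigr => w win; rewrite (shuffle_all _ win) (shuffle_size win).
case: (all _ u); case: (all _ v); rewrite /= ?mul0r ?mulr0 ?mul0rn //.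
rewrite size_shuffle -scalerAl -scalerAr scalerA -exprD.
rewrite scalerMnl; congr (_ *: _).
have := bin_fact (leq_addr (size v) (size u)); rewrite addKn -/n => E.
rewrite -mulr_natr -E !natrM !invfM mulrAC mulVf ?mul1r //.
by rewrite pnatr_eq0 -lt0n bin_gt0 leq_addr.
Qed.

(* exp (t alpha) for x = la and exp (t beta) for x = lb, in coordinates.     *)
Definition exp_point : Gamma A := mkGamma exp_point1 exp_pointM.

Lemma exp_pointE w : exp_point (wd w) =
  if w == nseq (size w) x then (size w)`!%:R^-1 *: t ^+ size w else 0.
Proof. exact: mkGammaE. Qed.

End OneParameter.

Section Sigma.
Variable A : comAlgType rat.
Implicit Types g h : Gamma A.

Fact sigma1 g : g (wd (map negb (rev [::]))) = 1.
Proof. by rewrite wd_nil rmorph1. Qed.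

Fact sigma_multM g (u v : word) :
  \sum_(w <- shuffle u v) g (wd (map negb (rev w))) =
  g (wd (map negb (rev u))) * g (wd (map negb (rev v))).
Proof.
rewrite -(shuffle_sum_rev (fun w => g (wd (map negb w)))).
rewrite -(shuffle_sum_map negb (fun w => g (wd w))) -rmorphM wdM raddf_sum.
by [].
Qed.

(* The anti-automorphism exchanging exp (t alpha) and exp (t beta): on words *)
(* it reverses the order of the letters and exchanges them.                  *)
Definition sigma g : Gamma A := mkGamma (sigma1 g) (sigma_multM g).

Lemma sigmaE g w : sigma g (wd w) = g (wd (map negb (rev w))).
Proof. exact: mkGammaE. Qed.

Lemma sigmaK : involutive sigma.
Proof.
move=> g; apply: Gamma_ext => w; rewrite !sigmaE -map_rev revK -map_comp.
by rewrite (eq_map negbK) map_id.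
Qed.

Lemma sigmaM g h : sigma (g * h)%g = (sigma h * sigma g)%g.
Proof.
apply: Gamma_ext => w; rewrite sigmaE !mkGammaE deconcat_map deconcat_rev.
by apply: eq_deconcat => p q; rewrite !sigmaE mulrC.
Qed.

Lemma sigma_exp_point x (t : A) : sigma (exp_point x t) = exp_point (~~ x) t.
Proof.
apply: Gamma_ext => w; rewrite sigmaE !exp_pointE size_map size_rev.
congr (if _ then _ else _); apply/eqP/eqP => E.
  rewrite -[w in LHS]revK -[rev w](mapK negbK) E map_nseq.
  by rewrite rev_nseq.
by rewrite {1}E rev_nseq map_nseq negbK.
Qed.

End Sigma.

Record symP (A : comAlgType rat) := SymP {
  symP_val : Gamma A;
  symP_sigma : sigma symP_val = symP_val
}.

Definition inK (A : comAlgType rat) (k : Gamma A) : Prop := sigma k = k^-1%g.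

Fact symP_sq_subproof (A : comAlgType rat) (p : symP A) :
  sigma (symP_val p * symP_val p)%g = (symP_val p * symP_val p)%g.
Proof. by rewrite sigmaM symP_sigma. Qed.

Definition symP_sq (A : comAlgType rat) (p : symP A) : symP A :=
  SymP (symP_sq_subproof p).

(* A regular function on P is a function on the points of P, with points in  *)
(* an arbitrary commutative Q-algebra, that is the restriction of an element *)
(* of Q[Gamma] = H; the value of f in H at g in Gamma(A) is g f.             *)
Record regP := RegP {
  regP_fun :> forall A : comAlgType rat, symP A -> A;
  regP_regular : exists f : shalg,
    forall (A : comAlgType rat) (p : symP A), regP_fun p = symP_val p f
}.

Definition extends (f : shalg) (phi : regP) : Prop :=
  forall (A : comAlgType rat) (p : symP A), symP_val p f = phi A p.

Definition right_K_invariant (f : shalg) : Prop :=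
  forall (A : comAlgType rat) (g k : Gamma A), inK k -> (g * k)%g f = g f.

Fact square_subproof (phi : regP) : exists f : shalg,
  forall (A : comAlgType rat) (p : symP A), phi A (symP_sq p) = symP_val p f.
Proof.
have [f fP] := regP_regular phi.
exists (lin (deconcat (fun u v => wd u * wd v)) f) => A p; rewrite fP.
pose F h := symP_val p (lin (deconcat (fun u v => wd u * wd v)) h).
move: f {fP}; apply: (@shalg_ext A _ F) => [c h k|c h k|w].
- by rewrite linearP.
- by rewrite /F !linearP.
rewrite /F lin_wd /deconcat linear_sum mkGammaE; apply: eq_bigr => i _.
by rewrite rmorphM.
Qed.

Definition square (phi : regP) : regP := RegP (square_subproof phi).

(* The word a b^t_1 a b^t_2 ... a b^t_k of W^+, with t = [:: t_1; ...; t_k]. *)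
Definition hword (t : seq nat) : word :=
  flatten [seq la :: nseq ti lb | ti <- t].

(* The sum over 0 < n_1 < ... < n_k < N of n_1^-r_1 ... n_k^-r_k z^n_k with  *)
(* r_i = 1 + t_i; for k = 0 it is 1.                                         *)
Definition multi_sum (K : numFieldType) (t : seq nat) (z : K) (N : nat) : K :=
  \sum_(n : (size t).-tuple 'I_N | path ltn 0%N [seq val i | i <- n])
    (\prod_(i < size t) (val (tnth n i))%:R ^- (nth 0%N t i).+1) *
    z ^+ last 0%N [seq val i | i <- n].

Definition multi_series (K : numFieldType) (t : seq nat) (z : K) : K :=
  limn (multi_sum t z).

Local Open Scope classical_set_scope.

Section Polylogarithms.
Variable R : realType.
Implicit Types (z : R[i]) (h : shalg).

(* The principal branch ln |z| + i arg z, with -pi < arg z <= pi.            *)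
Definition logC z : R[i] :=
  let r := Num.sqrt (complex.Re z ^+ 2 + complex.Im z ^+ 2) in
  let theta := acos (complex.Re z / r) in
  (ln r +i* (if 0 <= complex.Im z then theta else - theta))%C.

(* L is the algebra morphism H -> Hol(Omega) followed by evaluation at a     *)
(* point z of Omega, the open unit disc minus ]-1, 0]; since the operations  *)
(* of Hol(Omega) are pointwise, L is the only algebra morphism H -> C with   *)
(* these values on W^+ and b.                                                *)
Definition is_polylog z (L : {rmorphism shalg -> R[i]}) : Prop :=
  (forall t : seq nat, L (wd (hword t)) = multi_series t z) /\
  L (wd [:: lb]) = logC z.

(* [xget 0 A] is an element of A (0 if A is empty): here and below A is the  *)
(* singleton of the value being defined.                                     *)
Definition polylog h z : R[i] :=
  xget 0 [set v | exists2 L, is_polylog z L & v = L h].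

(* The nonempty words of W^{++} are those of W^+ with t_k > 0.               *)
Definition is_polyzeta (Z : {rmorphism shalg -> R[i]}) : Prop :=
  [/\ forall t : seq nat, (0 < last 1%N t)%N ->
        Z (wd (hword t)) = multi_series t 1,
      Z (wd [:: la]) = 0 & Z (wd [:: lb]) = 0].

Definition polyzeta h : R[i] :=
  xget 0 [set v | exists2 Z, is_polyzeta Z & v = Z h].

Definition polyzetaP (phi : regP) : R[i] :=
  xget 0 [set v | exists2 f, extends f phi & v = polyzeta f].

Definition polylogP (phi : regP) z : R[i] :=
  xget 0 [set v | exists2 f, extends f phi /\ right_K_invariant f
                           & v = polylog f z].

End Polylogarithms.

(* Main.v *)
(* Let L be the point of Gamma given by the polylogarithms at 1/2 and Z the   *)
(* one given by the polyzetas. For a word w of W^++ the function              *)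
(*   z |-> sum over w = u v of L_u(z) L_(sigma v)(1 - z)                      *)
(* has derivative 0, because d L = L (alpha dz/(1-z) + beta dz/z) and sigma   *)
(* exchanges the two forms as z becomes 1 - z; letting z tend to 1 gives      *)
(* zeta(w), and z = 1/2 gives Z = L sigma(L). If L = p k with p in P and k in *)
(* K, then Z = p^2, so that phi(Z) = phi(p^2) = (square phi)(p), which is the *)
(* value at L of the right K-invariant extension of square phi.               *)

From HB Require Import structures.
Require Import Defs.
From mathcomp Require Import all_boot all_order all_algebra.
From mathcomp Require Import complex.
From mathcomp Require Import all_classical all_reals all_analysis.
From mathcomp Require Import zify ring lra.
Import Order.TTheory GRing.Theory Num.Theory.
Import numFieldNormedType.Exports.

Set Implicit Arguments.
Unset Strict Implicit.
Unset Printing Implicit Defensive.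

Local Open Scope ring_scope.

(** * Square roots and the decomposition of Gamma as P K *)

(** Algebraic side: every point of [Gamma] has a unique square root, so each g is p k with p in P
    and k in K ([Gamma_symP_inK]). Then g sigma(g) = p^2, and a right K-invariant extension of
    [square phi] takes at g the value that an extension of [phi] takes at g sigma(g)
    ([square_extension_eval]). For g = L, the polylogarithms at 1/2, it remains to see that L
    sigma(L) is the point of the polyzetas.

    Analytic side: on single letters L sigma(L) vanishes because log z and log(1 - z) agree at 1/2.
    On a word of W^{++} it is the value at 1/2 of [Lreg_dual], which is constant on ]0,1[ because
    its derivative telescopes ([is_derive_Lreg_dual]), and this constant is the sum of the series
    defining the polyzeta ([series_li_coef_cvg]).

    The point L has to be constructed: [li_coef] gives power series freed of logarithms, and their
    shuffle relations follow from a differential equation ([Lreg_shuffle]). As [polylog] and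
    [polyzeta] choose among all morphisms with prescribed values, uniqueness is needed too
    ([polylog_unique], [polyzeta_unique]). *)

Section SquareRoot.
Variable A : comAlgType rat.
Implicit Types (g h k : Gamma A) (f : word -> A).

Lemma double_eq0 (x : A) : x + x = 0 -> x = 0.
Proof.
move=> /(congr1 (fun y => 2^-1 *: y)); rewrite scaler0 -mulr2n -scaler_nat.
by rewrite scalerA mulVf ?scale1r.
Qed.

Lemma sum_ends (n : nat) (F : nat -> A) : (0 < n)%N ->
  (forall i, (0 < i < n)%N -> F i = 0) -> \sum_(i < n.+1) F i = F 0%N + F n.
Proof.
case: n => // n _ F0; rewrite big_ord_recl big_ord_recr /= big1 ?add0r //.
by move=> i _; apply: F0; rewrite /= /bump /= add1n ltnS ltn_ord.
Qed.

(** Solves h h = g for h(w): as h is 1 on the empty word, the two extreme cuts of w both contribute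
    h(w). The argument [n] is fuel bounding the length of w. *)
Fixpoint sqrt_rec g (n : nat) (w : word) : A :=
  if n isn't m.+1 then 1 else if w is [::] then 1 else
  2^-1 *: (g (wd w) - \sum_(i < (size w).-1)
             sqrt_rec g m (take i.+1 w) * sqrt_rec g m (drop i.+1 w)).

Definition sqrt_word g w := sqrt_rec g (size w) w.

Lemma sqrt_rec_fuel g n w : (size w <= n)%N -> sqrt_rec g n w = sqrt_word g w.
Proof.
rewrite /sqrt_word; have [k] := ubnP (size w).
elim: k n w => // k IH [|n] [|x w] //= kw wn.
congr (_ *: (_ - _)); apply: eq_bigr => i _.
have iw := ltn_ord i; have tk := size_takel (ltnW iw).
rewrite !IH ?(IH (size w)) ?size_drop //=; move: iw kw wn => /=; lia.
Qed.

Lemma sqrt_wordK g w :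
  deconcat (fun p q => sqrt_word g p * sqrt_word g q) w = g (wd w).
Proof.
case: w => [|x w]; first by rewrite deconcat_nil mulr1 wd_nil rmorph1.
rewrite /deconcat big_ord_recl big_ord_recr /=.
rewrite drop_size take_size mul1r mulr1.
set S := \sum_(i < _) _.
suff -> : sqrt_word g (x :: w) = 2^-1 *: (g (wd (x :: w)) - S).
  rewrite addrCA -scalerDl (_ : 2^-1 + 2^-1 = 1 :> rat) //.
  by rewrite scale1r addrC subrK.
rewrite {1}/sqrt_word /=; congr (_ *: (_ - _)); apply: eq_bigr => i _.
have iw := ltn_ord i; have tk := size_takel (ltnW iw).
rewrite !sqrt_rec_fuel ?size_drop //=; try lia.
Qed.

(** The square of h is multiplicative. Expanding it over pairs of cuts of u and v gives two double
    sums whose terms agree, by induction on the total length, except at the two extreme pairs. Each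
    of these contributes the same defect, so twice the defect is 0. *)
Lemma sqrt_wordM g u v :
  \sum_(w <- shuffle u v) sqrt_word g w = sqrt_word g u * sqrt_word g v.
Proof.
set h := sqrt_word g.
pose T u v := \sum_(w <- shuffle u v) h w.
have T0 v' : T [::] v' = h v' by rewrite /T big_seq1.
have T0r u' : T u' [::] = h u' by rewrite /T; case: u' => *; rewrite big_seq1.
rewrite -/(T u v); have [n] := ubnP (size u + size v)%N.
elim: n u v => // n IH [|x u] v; first by rewrite T0 mul1r.
case: v => [|y v]; first by rewrite T0r mulr1.
set U := x :: u; set V := y :: v => le_n.
have E1 : \sum_(w <- shuffle U V) deconcat (fun p q => h p * h q) w =
    \sum_(i < (size U).+1) \sum_(j < (size V).+1)
      T (take i U) (take j V) * T (drop i U) (drop j V).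
  rewrite shuffle_sum_deconcat; apply: eq_bigr => i _; apply: eq_bigr => j _.
  by rewrite big_distrlr.
have E2 : \sum_(w <- shuffle U V) deconcat (fun p q => h p * h q) w =
    \sum_(i < (size U).+1) \sum_(j < (size V).+1)
      (h (take i U) * h (take j V)) * (h (drop i U) * h (drop j V)).
  under eq_bigr do rewrite sqrt_wordK.
  transitivity (g (wd U * wd V)); first by rewrite wdM raddf_sum.
  have -> : g (wd U * wd V) = g (wd U) * g (wd V) by exact: rmorphM.
  rewrite -!sqrt_wordK /deconcat big_distrlr.
  by apply: eq_bigr => i _; apply: eq_bigr => j _; rewrite mulrACA.
pose D i j := T (take i U) (take j V) * T (drop i U) (drop j V) -
  (h (take i U) * h (take j V)) * (h (drop i U) * h (drop j V)).
have Dsum : \sum_(i < (size U).+1) \sum_(j < (size V).+1) D i j = 0.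
  rewrite /D; under eq_bigr do rewrite sumrB.
  by rewrite sumrB -E1 -E2 subrr.
have D0 i j : (i <= size U)%N -> (j <= size V)%N -> (0 < i + j)%N ->
    (i + j < size U + size V)%N -> D i j = 0.
  move=> iU jV ij0 ijn; rewrite /D !IH ?subrr //.
    by rewrite !size_drop -ltnS; apply: leq_trans le_n; lia.
  by rewrite !size_takel //; lia.
have U0 : (0 < size U)%N by []. have V0 : (0 < size V)%N by [].
move: Dsum; rewrite (sum_ends (F := fun i => \sum_(j < (size V).+1) D i j)) //;
  last first.
  by move=> i iU; apply: big1 => j _; apply: D0; have := ltn_ord j; lia.
rewrite big_ord_recl big1 ?addr0; last first.
  by move=> j _; apply: D0; have := ltn_ord j; rewrite /= /bump; lia.
rewrite big_ord_recr big1 ?add0r; last first.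
  by move=> j _; apply: D0; have := ltn_ord j; rewrite /=; lia.
rewrite /D !take0 !drop0 !drop_size !take_size T0 (erefl : h [::] = 1) !mul1r
  !mulr1 -/(T U V).
move=> D2; apply/eqP; rewrite -subr_eq0; apply/eqP; apply: double_eq0.
by rewrite -[X in _ + X]add0r; exact: D2.
Qed.

Definition Gamma_sqrt g : Gamma A := mkGamma (erefl : sqrt_word g [::] = 1)
  (sqrt_wordM g).

Lemma Gamma_sqrtK g : (Gamma_sqrt g * Gamma_sqrt g)%g = g.
Proof.
apply: Gamma_ext => w; rewrite mkGammaE -[RHS]sqrt_wordK.
by apply: eq_deconcat => p q; rewrite !mkGammaE.
Qed.

Lemma Gamma_sqr_inj g h : (g * g = h * h)%g -> g = h.
Proof.
move=> E; apply: Gamma_ext => w; have [n] := ubnP (size w).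
elim: n w => // n IH [|x w]; first by rewrite wd_nil !rmorph1.
set W := x :: w => Wn; have := congr1 (fun k : Gamma A => k (wd W)) E.
rewrite !Gamma_mulE => /eqP; rewrite -subr_eq0 -sumrB.
rewrite (sum_ends (F := fun i => g (wd (take i W)) * g (wd (drop i W)) -
  h (wd (take i W)) * h (wd (drop i W)))) //; last first.
  move=> i iW; rewrite !IH ?subrr // ?size_drop ?size_takel; lia.
rewrite take0 drop0 take_size drop_size wd_nil !rmorph1 !mul1r !mulr1.
by move/eqP/double_eq0/eqP; rewrite subr_eq0 => /eqP.
Qed.

(** Polar decomposition, with p the square root of g sigma(g). The square of sigma(p) is the same,
    so p lies in P by uniqueness of square roots; then p^-1 g lies in K because p p = g sigma(g). *)
Lemma Gamma_symP_inK g :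
  exists (p : symP A) (k : Gamma A), inK k /\ g = (symP_val p * k)%g.
Proof.
set p := Gamma_sqrt (g * sigma g)%g.
have pp : (p * p = g * sigma g)%g by exact: Gamma_sqrtK.
have sp : sigma p = p.
  by apply: Gamma_sqr_inj; rewrite -sigmaM pp sigmaM sigmaK.
exists (SymP sp), (p^-1 * g)%g; split; last by rewrite mulVKg.
have sV : sigma p^-1%g = (p^-1)%g.
  have s1 : sigma (1 : Gamma A)%g = 1%g.
    apply: (@mulgI _ (sigma 1%g)).
    by rewrite -sigmaM !mulg1.
  by apply: (@mulgI _ p); rewrite mulgV -{1}sp -sigmaM mulVg s1.
rewrite /inK sigmaM sV invgM invgK.
by apply: (@mulgI _ g); rewrite !mulgA mulgV mul1g -pp mulgK.
Qed.

End SquareRoot.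

(** * Right K-invariant extensions of squares *)

Section Extensions.
Variable phi : regP.

Definition coproduct_sigma (f : shalg) : shalg :=
  lin (deconcat (fun u v => wd u * wd (map negb (rev v)))) f.

Lemma coproduct_sigmaE (A : comAlgType rat) (g : Gamma A) f :
  g (coproduct_sigma f) = (g * sigma g)%g f.
Proof.
pose F h := g (coproduct_sigma h); rewrite -[LHS]/(F f).
move: f; apply: (@shalg_ext A F) => [c h k|c h k|w].
- by rewrite /F /coproduct_sigma !linearP.
- by rewrite linearP.
rewrite /F /coproduct_sigma lin_wd /deconcat linear_sum mkGammaE.
by apply: eq_bigr => i _; rewrite rmorphM sigmaE.
Qed.

(** The map sending g to g sigma(g) is squaring on P and does not change when g is multiplied on the
    right by an element of K. *)
Lemma square_right_K_invariant_extension f : extends f phi ->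
  extends (coproduct_sigma f) (square phi) /\
  right_K_invariant (coproduct_sigma f).
Proof.
move=> ef; split=> [A p|A g k kK]; rewrite !coproduct_sigmaE.
  by rewrite symP_sigma -[RHS]/(phi A (symP_sq p)) -ef.
by rewrite sigmaM (kK : sigma k = _) !mulgA mulgK.
Qed.

(** Writing g = p k, both sides are [phi] at p^2. *)
Lemma square_extension_eval f f2 (A : comAlgType rat) (g : Gamma A) :
  extends f phi -> extends f2 (square phi) -> right_K_invariant f2 ->
  g f2 = (g * sigma g)%g f.
Proof.
move=> ef ef2 kf2; have [p [k [kK ->]]] := Gamma_symP_inK g.
rewrite kf2 // ef2 -[LHS]/(phi A (symP_sq p)) -ef.
by rewrite sigmaM (kK : sigma k = _) symP_sigma !mulgA mulgK.
Qed.

End Extensions.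

(** * Morphisms on the shuffle algebra are determined by regularised values *)

(* A field of characteristic 0 has no canonical structure of Q-algebra, hence *)
(* this copy of it.                                                           *)
Definition ratAlg (F : numFieldType) : Type := F.

Section RatAlg.
Variable F : numFieldType.
HB.instance Definition _ := GRing.ComNzRing.copy (ratAlg F) F.

Definition ratAlg_scale (q : rat) (x : ratAlg F) : ratAlg F := ratr q * (x : F).

Fact ratAlg_scaleA a b x :
  ratAlg_scale a (ratAlg_scale b x) = ratAlg_scale (a * b) x.
Proof. by rewrite /ratAlg_scale rmorphM mulrA. Qed.

Fact ratAlg_scale1 : left_id 1 ratAlg_scale.
Proof. by move=> x; rewrite /ratAlg_scale rmorph1 mul1r. Qed.

Fact ratAlg_scaleDr : right_distributive ratAlg_scale +%R.
Proof. by move=> a x y; rewrite /ratAlg_scale mulrDr. Qed.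

Fact ratAlg_scaleDl x : {morph ratAlg_scale^~ x : a b / a + b}.
Proof. by move=> a b; rewrite /ratAlg_scale rmorphD mulrDl. Qed.

HB.instance Definition _ := GRing.Zmodule_isLmodule.Build rat (ratAlg F)
  ratAlg_scaleA ratAlg_scale1 ratAlg_scaleDr ratAlg_scaleDl.

Fact ratAlg_scaleAl (c : rat) (x y : ratAlg F) : c *: (x * y) = (c *: x) * y.
Proof. exact: mulrA. Qed.

HB.instance Definition _ :=
  GRing.Lmodule_isLalgebra.Build rat (ratAlg F) ratAlg_scaleAl.
HB.instance Definition _ := GRing.Lalgebra_isComAlgebra.Build rat (ratAlg F).

End RatAlg.
Section Regularization.

Lemma shuffle1_cons (x y : letter) s :
  shuffle [:: x] (y :: s) = [:: x, y & s] :: map (cons y) (shuffle [:: x] s).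
Proof. by []. Qed.

Lemma sum_shuffle1_nseq (V : nmodType) (F : word -> V) x n :
  \sum_(w <- shuffle [:: x] (nseq n x)) F w = F (nseq n.+1 x) *+ n.+1.
Proof.
elim: n F => [|n IH] F; first by rewrite /= big_seq1.
by rewrite [nseq n.+1 x]/= shuffle1_cons big_cons big_map IH [RHS]mulrS.
Qed.

Lemma sum_shuffle1_cat (V : nmodType) (F : word -> V) x n y s :
  \sum_(w <- shuffle [:: x] (nseq n x ++ y :: s)) F w =
  F (nseq n.+1 x ++ y :: s) *+ n.+1 +
  \sum_(w <- shuffle [:: x] s) F (nseq n x ++ y :: w).
Proof.
elim: n F => [|n IH] F.
  by rewrite /= big_cons big_map mulr1n.
rewrite [nseq n.+1 x]/= [(_ :: _) ++ _]/= shuffle1_cons big_cons big_map IH.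
by rewrite [in RHS]mulrS addrA.
Qed.

Lemma nseq_lb_prefix (w : word) :
  exists n s, w = nseq n lb ++ s /\ head la s = la.
Proof.
elim: w => [|x w [n [s [-> hs]]]]; first by exists 0%N, [::].
by case: x; [exists n.+1, s | exists 0%N, (la :: nseq n lb ++ s)].
Qed.

Lemma last_shuffle1 x y (s w : word) :
  w \in shuffle [:: x] s -> last y w = x \/ last y w = last y s.
Proof.
elim: s y w => [|z s IH] y w; first by rewrite inE => /eqP ->; left.
rewrite shuffle1_cons inE => /orP[/eqP ->|/mapP[w' w'in ->]]; first by right.
by rewrite /=; exact: IH.
Qed.

(* Shuffling [b] into [b^n a s] yields [n + 1] times [b^(n+1) a s] plus words *)
(* with only [n] leading letters [b], whence an induction on [n].             *)
Lemma shuffle_morphism_unique (K : numFieldType) (p : pred letter)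
    (F G : word -> K) : p lb ->
  (forall u v, \sum_(w <- shuffle u v) F w = F u * F v) ->
  (forall u v, \sum_(w <- shuffle u v) G w = G u * G v) ->
  F [:: lb] = G [:: lb] ->
  (forall w, head la w = la -> p (last lb w) -> F w = G w) ->
  forall w, p (last lb w) -> F w = G w.
Proof.
move=> pb FM GM FGb FG w; have [n [s [-> hs]]] := nseq_lb_prefix w.
have last_b m t : last lb (nseq m lb ++ t) = last lb t by elim: m.
rewrite last_b; elim: n s hs => [|n IH] s hs ps; first exact: FG.
have Fn := FM [:: lb] (nseq n lb ++ s); have Gn := GM [:: lb] (nseq n lb ++ s).
have n0 : n.+1%:R != 0 :> K by rewrite pnatr_eq0.
apply: (mulIf n0); rewrite !mulr_natr.
case: s hs ps Fn Gn => [|[] s] //= _ ps.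
  rewrite cats0 !sum_shuffle1_nseq => -> ->; rewrite FGb; congr (_ * _).
  by rewrite -[nseq n lb]cats0; apply: IH.
rewrite !sum_shuffle1_cat !(IH (la :: s)) // FGb => <- /eqP.
rewrite [X in _ + X](_ : _ = \sum_(w <- shuffle [:: lb] s)
    F (nseq n lb ++ la :: w)); first by rewrite -subr_eq addrK => /eqP ->.
(* Inserting a b either keeps the last letter or makes it b, so [p] still holds. *)
rewrite !big_seq; apply: eq_bigr => v vin; apply/esym; apply: IH => //=.
by case: (last_shuffle1 la vin) => ->.
Qed.

Lemma hword_rcons t m : hword (rcons t m) = hword t ++ la :: nseq m lb.
Proof. by rewrite /hword map_rcons flatten_rcons. Qed.

(** The defaults in [head la] and [last lb] count the empty word in W^+ and W^{++}. Reading from the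
    right, a final b raises the last exponent and a final a opens a new one. *)
Lemma hwordP (w : word) : head la w = la -> exists t, w = hword t.
Proof.
elim/last_ind: w => [|w x IH]; first by exists [::].
case: x => [|hw]; last first.
  have [|t ->] := IH; first by case: w hw {IH} => [|y w].
  by exists (rcons t 0%N); rewrite hword_rcons cats1.
case: w IH => [|x w] IH //= hx; have [//|t] := IH.
case: (lastP t) => // {}t m E; exists (rcons t m.+1).
rewrite -rcons_cons E !hword_rcons rcons_cat rcons_cons; congr (_ ++ la :: _).
by elim: (m) => //= k ->.
Qed.

Lemma head_hword t : head la (hword t) = la.
Proof. by case: t. Qed.

Lemma last_hword t : last lb (hword t) = (0 < last 1%N t)%N.
Proof.
case/lastP: t => // t m; rewrite hword_rcons last_cat last_rcons /=.
by case: m => //= m; elim: m.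
Qed.

Lemma rmorphism_shuffle (K : comNzRingType) (f : {rmorphism shalg -> K}) u v :
  \sum_(w <- shuffle u v) f (wd w) = f (wd u) * f (wd v).
Proof. by rewrite -rmorphM wdM raddf_sum. Qed.

(** A ring morphism to a field of characteristic 0 is automatically Q-linear, so agreement on the
    basis suffices. *)
Lemma rmorphism_wd_ext (K : numFieldType) (f g : {rmorphism shalg -> K}) :
  (forall w, f (wd w) = g (wd w)) -> f =1 g.
Proof.
move=> E h; have Z (k : {rmorphism shalg -> K}) c x : k (c *: x) = ratr c * k x.
  rewrite -[x in LHS]mul1r scalerAl rmorphM; congr (_ * _).
  by rewrite -[c%:A]/(in_alg shalg c) -[LHS]/((k \o in_alg shalg) c)
    fmorph_eq_rat.
have L (k : {rmorphism shalg -> K}) : linear (k : shalg -> ratAlg K).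
  by move=> c x y; rewrite -[LHS]/(k (c *: x + y)) rmorphD Z.
exact: (shalg_ext (L f) (L g)).
Qed.

Lemma polylog_unique (K : numFieldType) (f g : {rmorphism shalg -> K}) :
  (forall t, f (wd (hword t)) = g (wd (hword t))) ->
  f (wd [:: lb]) = g (wd [:: lb]) -> f =1 g.
Proof.
move=> fgt fgb; apply: rmorphism_wd_ext => w.
apply: (@shuffle_morphism_unique K predT (fun w => f (wd w))
  (fun w => g (wd w)) isT (rmorphism_shuffle f) (rmorphism_shuffle g) fgb).
  by move=> v hv _; have [t ->] := hwordP hv.
by [].
Qed.

(** Regularisation at both ends. [polylog_unique] reduces to W^+; reversing words and exchanging
    letters then turns final letters a into leading letters b. The predicate [id] on the last letter
    keeps this second induction inside the reversals of W^+. *)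
Lemma polyzeta_unique (K : numFieldType) (f g : {rmorphism shalg -> K}) :
  (forall t, (0 < last 1%N t)%N -> f (wd (hword t)) = g (wd (hword t))) ->
  f (wd [:: la]) = g (wd [:: la]) -> f (wd [:: lb]) = g (wd [:: lb]) -> f =1 g.
Proof.
move=> fgt fga fgb; apply: polylog_unique => // t.
pose nr (w : word) := map negb (rev w).
have nrK : involutive nr.
  move=> w; rewrite /nr -map_rev revK -map_comp.
  by rewrite (eq_map negbK) map_id.
have FM (h : {rmorphism shalg -> K}) u v :
    \sum_(w <- shuffle u v) h (wd (nr w)) = h (wd (nr u)) * h (wd (nr v)).
  rewrite -(shuffle_sum_rev (fun w => h (wd (map negb w)))).
  rewrite -(shuffle_sum_map negb (fun w => h (wd w))).
  exact: rmorphism_shuffle.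
have last_nr w : last lb (nr w) = ~~ head la w.
  by case: w => //= x w; rewrite /nr rev_cons map_rcons last_rcons.
rewrite -[hword t]nrK.
apply: (@shuffle_morphism_unique K id (fun w => f (wd (nr w)))
  (fun w => g (wd (nr w))) isT (FM f) (FM g) fga _ (nr (hword t)));
  last by rewrite last_nr head_hword.
move=> w hw pw; have hnr : head la (nr w) = la.
  by apply: negb_inj; rewrite -last_nr nrK.
have [s Es] := hwordP hnr; rewrite Es; apply: fgt.
by rewrite -last_hword -Es last_nr hw.
Qed.

End Regularization.


(** * Power series with coefficients of subexponential growth *)

Section PowerSeries.
Variable R : realType.
Implicit Types (c d : nat -> R) (z r : R).

Local Open Scope classical_set_scope.

(** Equivalent to a radius of convergence of at least 1, in a form stable under shifts and
    multiplication by n, hence under termwise differentiation. *)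
Definition subgeometric c :=
  forall r, 0 <= r < 1 -> exists M, forall n, `|c n| * r ^+ n <= M.

Definition psum c z : R := limn (pseries c z).

Lemma bounded_subgeometric c M : (forall n, `|c n| <= M) -> subgeometric c.
Proof.
move=> cM r /andP[r0 r1]; exists M => n; apply: le_trans (cM n).
by rewrite ler_piMr // exprn_ile1 // ltW.
Qed.

Lemma subgeometric_le c d :
  (forall n, `|d n| <= `|c n|) -> subgeometric c -> subgeometric d.
Proof.
move=> dc cs r r01; have [M cM] := cs r r01; exists M => n.
by apply: le_trans (cM n); rewrite ler_wpM2r // exprn_ge0 //; case/andP: r01.
Qed.

Lemma mid_lt1 r : 0 <= r < 1 -> [/\ 0 < (r + 1) / 2, r < (r + 1) / 2 & (r + 1)
  / 2 < 1].
Proof. by move=> /andP[r0 r1]; split; lra. Qed.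

Lemma sum_geometric_le r k : 0 <= r < 1 -> \sum_(i < k) r ^+ i <= (1 - r)^-1.
Proof.
move=> /andP[r0 r1]; have r1' : 0 < 1 - r by lra.
rewrite -[leRHS]mulr1 ler_pdivlMl // -opprB mulNr -subrX1 opprB.
by rewrite gerBl exprn_ge0.
Qed.

Lemma natr_geometric_le r n : 0 <= r < 1 -> n%:R * r ^+ n <= (1 - r)^-1.
Proof.
move=> r01; apply: le_trans (sum_geometric_le n r01); have /andP[r0 r1] := r01.
rewrite mulr_natl -[n in _ *+ n]card_ord -sumr_const.
by apply: ler_sum => i _; rewrite ler_wiXn2l // ?ltW // ltnW.
Qed.

Lemma subgeometric_natr c : subgeometric c -> subgeometric (fun n => n%:R * c
  n).
Proof.
move=> cs r r01; have [m0 rm m1] := mid_lt1 r01;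
  set s := (r + 1) / 2 in m0 rm m1; clearbody s.
have [|M cM] := cs s; first by rewrite ltW.
have q01 : 0 <= r / s < 1.
  by case/andP: r01 => r0 _; rewrite divr_ge0 ?(ltW m0) //= ltr_pdivrMr //
    mul1r.
exists ((1 - r / s)^-1 * M) => n.
rewrite normrM ger0_norm //.
have -> : n%:R * `|c n| * r ^+ n = (n%:R * (r / s) ^+ n) * (`|c n| * s ^+ n).
  by rewrite expr_div_n; field; rewrite expf_neq0 // gt_eqF.
apply: ler_pM => //; last exact: natr_geometric_le.
- by rewrite mulr_ge0 // exprn_ge0 //; case/andP: q01.
- by rewrite mulr_ge0 // exprn_ge0 // ltW.
Qed.

Lemma subgeometric_shift c : subgeometric c -> subgeometric (fun n => c n.+1).
Proof.
move=> cs r r01; have [m0 rm m1] := mid_lt1 r01;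
  set s := (r + 1) / 2 in m0 rm m1; clearbody s.
have [|M cM] := cs s; first by rewrite ltW.
exists (M / s) => n; rewrite ler_pdivlMr //; apply: le_trans (cM n.+1).
rewrite exprSr mulrA ler_pM2r // ler_wpM2l // lerXn2r ?nnegrE ?(ltW m0) ?(ltW
  rm) //.
by case/andP: r01.
Qed.

Lemma pseries_cvg c z : subgeometric c -> `|z| < 1 -> pseries c z @ \oo -->
  psum c z.
Proof.
move=> cs z1; apply: normed_cvg.
have r01 : 0 <= `|z| < 1 by rewrite normr_ge0.
have [m0 rm m1] := mid_lt1 r01; set s := (_ + 1) / 2 in m0 rm m1; clearbody s.
have [|M cM] := cs s; first by rewrite ltW.
apply: (@series_le_cvg _ _ (geometric M (`|z| / s))) => [n|n|n|].
- exact: normr_ge0.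
- have M0 : 0 <= M by apply: le_trans (cM 0%N); rewrite mulr_ge0.
  by rewrite /geometric /= mulr_ge0 // exprn_ge0 // divr_ge0 // ltW.
- rewrite /geometric /= normrM normrX expr_div_n mulrA ler_pdivlMr ?exprn_gt0
  //.
  by rewrite mulrAC ler_wpM2r // exprn_ge0.
apply: is_cvg_geometric_series.
by rewrite ger0_norm ?divr_ge0 ?(ltW m0) // ltr_pdivrMr // mul1r.
Qed.

Lemma psumE c z l : pseries c z @ \oo --> l -> psum c z = l.
Proof. exact: cvg_lim. Qed.

Lemma psum_shift c z : subgeometric c -> `|z| < 1 ->
  psum c z = c 0%N + z * psum (fun n => c n.+1) z.
Proof.
move=> cs z1; apply: psumE; rewrite -cvg_shiftS.
have -> : [sequence pseries c z n.+1]_n =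
    (fun n => c 0%N + z * pseries (fun n => c n.+1) z n).
  apply/funext => n; rewrite /pseries /series /= big_nat_recl // expr0 mulr1.
  congr (_ + _); rewrite mulr_sumr; apply: eq_bigr => i _.
  by rewrite exprS mulrCA.
apply: cvgD; first exact: cvg_cst.
apply: cvgMr; exact: (pseries_cvg (subgeometric_shift cs)).
Qed.

Lemma psumB c d z : subgeometric c -> subgeometric d -> `|z| < 1 ->
  psum (fun n => c n - d n) z = psum c z - psum d z.
Proof.
move=> cs ds z1; apply: psumE.
have -> : pseries (fun n => c n - d n) z = pseries c z - pseries d z.
  apply/funext => n; rewrite fctE /pseries /series /= -sumrB.
  by apply: eq_bigr => i _; rewrite mulrBl.
by apply: cvgB; exact: pseries_cvg.
Qed.

(** The sums stop strictly below n, so the two series satisfy D = z (D + C); hence the factor z / (1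
    - z) and not 1 / (1 - z). *)
Lemma psum_partial_sums c z : subgeometric c -> subgeometric (fun n => \sum_(m
  < n) c m) ->
  `|z| < 1 -> psum (fun n => \sum_(m < n) c m) z = z / (1 - z) * psum c z.
Proof.
move=> cs ds z1; have H1 := psum_shift ds z1; rewrite big_ord0 add0r in H1.
have H2 := psumB (subgeometric_shift ds) ds z1.
have E : (fun n => \sum_(m < n.+1) c m - \sum_(m < n) c m) = c.
  by apply/funext => n; rewrite big_ord_recr /= addrAC subrr add0r.
rewrite E in H2; rewrite H2 H1; field.
by rewrite subr_eq0 eq_sym lt_eqF // (le_lt_trans (ler_norm z)).
Qed.

Lemma is_derive_psum c z : subgeometric c -> `|z| < 1 ->
  is_derive z 1 (psum c) (psum (pseries_diffs c) z).
Proof.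
move=> cs z1; have ds d : subgeometric d -> subgeometric (pseries_diffs d).
  by move=> /subgeometric_natr/subgeometric_shift.
have [m0 rm m1] : [/\ 0 < (`|z| + 1) / 2, `|z| < (`|z| + 1) / 2 & (`|z| + 1) /
  2 < 1].
  by apply: mid_lt1; rewrite normr_ge0.
set s := (_ + 1) / 2 in m0 rm m1; clearbody s.
have s1 : `|s| < 1 by rewrite gtr0_norm.
apply: (@pseries_snd_diffs _ c s); last by rewrite (gtr0_norm m0).
- by apply/cvgP: (pseries_cvg cs s1).
- by apply/cvgP: (pseries_cvg (ds _ cs) s1).
- by apply/cvgP: (pseries_cvg (ds _ (ds _ cs)) s1).
Qed.

Lemma mul_psum_diffs c z : subgeometric c -> `|z| < 1 ->
  z * psum (pseries_diffs c) z = psum (fun n => n%:R * c n) z.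
Proof.
by move=> cs z1; rewrite [RHS]psum_shift ?mul0r ?add0r //;
  exact: subgeometric_natr.
Qed.

Lemma psum0 c : psum c 0 = c 0%N.
Proof.
apply: psumE; rewrite -cvg_shiftS.
have -> : [sequence pseries c 0 n.+1]_n = (fun=> c 0%N); last exact: cvg_cst.
apply/funext => n; rewrite /pseries /series /= big_nat_recl // expr0 mulr1.
by rewrite big1 ?addr0 // => i _; rewrite exprS mul0r mulr0.
Qed.

Lemma derivative0_eq (f : R -> R) a b : a <= b ->
  (forall x, a <= x <= b -> derivable f x 1) ->
  (forall x, a < x < b -> is_derive x 1 f 0) -> f a = f b.
Proof.
move=> ab fd f0.
have fc : {within `[a, b], continuous f}.
  by apply: derivable_within_continuous => x; rewrite in_itv => /fd.
have fd0 x : x \in `]a, b[%R -> is_derive x 1 f 0 by rewrite in_itv => /f0.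
have [c _ /eqP] := MVT_segment ab fd0 fc.
by rewrite mul0r subr_eq0 => /eqP.
Qed.

End PowerSeries.

(** * Polylogarithms *)

Section Coefficients.
Variable R : realType.
Implicit Types (u v w : word) (z : R).

(** Coefficientwise solution of z y' = y (beta + z/(1 - z) alpha) - beta y: right multiplication
    cuts off the last letter, left multiplication by beta a leading b. *)
Fixpoint li_coef_rec k w n : R :=
  if k isn't k'.+1 then (n == 0%N)%:R else
  n%:R^-1 * ((if last lb w then li_coef_rec k' (take k' w) n
              else \sum_(m < n) li_coef_rec k' (take k' w) m) -
             (head la w)%:R * li_coef_rec k' (behead w) n).

(* Taylor coefficients of [exp (- log z beta) L z]. On W^+ they are those of  *)
(* [L]; for the other words, subtracting the word without its leading [b]     *)
(* removes the logarithm. Division by 0 gives [li_coef w 0 = 0] for nonempty  *)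
(* [w].                                                                       *)
Definition li_coef w : nat -> R := li_coef_rec (size w) w.

Lemma li_coef_nil n : li_coef [::] n = (n == 0%N)%:R.
Proof. by []. Qed.

Definition belast_word w := take (size w).-1 w.

Lemma belast_word_rcons w x : belast_word (rcons w x) = w.
Proof. by rewrite /belast_word size_rcons -cats1 take_size_cat. Qed.

Lemma li_coefE w n : w != [::] ->
  li_coef w n = n%:R^-1 *
    ((if last lb w then li_coef (belast_word w) n
      else \sum_(m < n) li_coef (belast_word w) m) -
     (head la w)%:R * li_coef (behead w) n).
Proof.
case: w => // x w _; rewrite /li_coef /belast_word size_takel //=.
Qed.

Lemma li_coef0 w : li_coef w 0%N = (w == [::])%:R.
Proof.
by case: (eqVneq w [::]) => [->|wn]; rewrite ?li_coef_nil // li_coefE // invr0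
  mul0r.
Qed.

(** At n = 0, where the recursion divides by 0, the right-hand side must vanish by itself; for the
    word b this is the cancellation 1 - 1. *)
Lemma natr_li_coef w n : w != [::] ->
  n%:R * li_coef w n =
    (if last lb w then li_coef (belast_word w) n
     else \sum_(m < n) li_coef (belast_word w) m) -
    (head la w)%:R * li_coef (behead w) n.
Proof.
move=> wn; case: n => [|n]; last by rewrite li_coefE // mulVKf // pnatr_eq0.
rewrite mul0r big_ord0 !li_coef0.
case: w wn => // x w _; rewrite /= /belast_word -size_eq0 size_takel;
  last exact: leqnSn.
case: w => [|y w] /=; first by case: x; rewrite /= ?mul0r ?mul1r subrr.
by rewrite mulr0; case: ifP; rewrite subr0.
Qed.

Lemma li_coef_bounded w n : `|li_coef w n| <= 2 ^+ size w.
Proof.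
have [k] := ubnP (size w); elim: k w n => // k IH w n wk.
have [->|wn] := eqVneq w [::].
  by rewrite li_coef_nil expr0; case: eqP; rewrite /= ?normr1 ?normr0.
have sw : (0 < size w)%N by case: w wn {wk}.
case: n => [|n]; first by rewrite li_coef0 (negPf wn) normr0 exprn_ge0.
rewrite li_coefE // normrM ger0_norm ?invr_ge0 // ler_pdivrMl ?ltr0n //.
set M : R := 2 ^+ (size w).-1.
have sb : size (belast_word w) = (size w).-1 by rewrite size_takel ?leq_pred.
have IHb m : `|li_coef (belast_word w) m| <= M.
  by rewrite /M -sb; apply: IH; rewrite sb; lia.
have IHh m : `|li_coef (behead w) m| <= M.
  by rewrite /M -size_behead; apply: IH; rewrite size_behead; lia.
have M0 : 0 <= M by rewrite exprn_ge0.
have -> : 2 ^+ size w = M + M :> R by rewrite -[in LHS](prednK sw) exprS -/M;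
  ring.
rewrite mulrDr; apply: le_trans (ler_normB _ _) _; apply: lerD; last first.
  rewrite normrM; apply: (@le_trans _ _ (1 * M)).
    by apply: ler_pM => //; case: (head la w); rewrite /= ?normr1 ?normr0.
  by rewrite ler_wpM2r // ler1n.
case: ifP => _.
  by apply: le_trans (IHb _) _; rewrite ler_peMl // ler1n.
apply: le_trans (ler_norm_sum _ _ _) _.
apply: (@le_trans _ _ (\sum_(i < n.+1) M)); first exact: ler_sum.
by rewrite sumr_const card_ord mulr_natl.
Qed.

Lemma li_coef_subgeometric w : subgeometric (li_coef w).
Proof. exact: bounded_subgeometric (li_coef_bounded w). Qed.

Lemma li_coef_sums_subgeometric w : subgeometric (fun n => \sum_(m < n) li_coef
  w m).
Proof.
have c2 : subgeometric (fun n => 2 ^+ size w : R).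
  by apply: (@bounded_subgeometric _ _ (2 ^+ size w)) => n;
    rewrite ger0_norm // exprn_ge0.
apply: subgeometric_le (subgeometric_natr c2) => n.
rewrite [leRHS]ger0_norm ?mulr_ge0 ?exprn_ge0 // mulr_natl.
apply: le_trans (ler_norm_sum _ _ _) _.
rewrite -[n in leRHS]card_ord -sumr_const.
by apply: ler_sum => i _; exact: li_coef_bounded.
Qed.

Definition Lreg w z : R := psum (li_coef w) z.

Lemma Lreg_nil z : Lreg [::] z = 1.
Proof.
apply: psumE; rewrite -cvg_shiftS.
have -> : [sequence pseries (li_coef [::]) z n.+1]_n = (fun=> 1 : R);
  last exact: cvg_cst.
apply/funext => n; rewrite /pseries /series /= big_nat_recl //= mulr1.
by rewrite big1 ?addr0 // => i _; rewrite li_coef_nil mul0r.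
Qed.

Lemma Lreg0 w : Lreg w 0 = (w == [::])%:R.
Proof. by rewrite /Lreg psum0 li_coef0. Qed.

Definition zkernel (x : letter) z : R := if x then 1 else z / (1 - z).

Definition drop_last w z := zkernel (last lb w) z * Lreg (belast_word w) z.
Definition drop_first w z := (head la w)%:R * Lreg (behead w) z.

Lemma drop_first_cons x w z : drop_first (x :: w) z = x%:R * Lreg w z.
Proof. by []. Qed.

Definition dLreg w z : R := psum (pseries_diffs (li_coef w)) z.

Lemma is_derive_Lreg w z : `|z| < 1 -> is_derive z 1 (Lreg w) (dLreg w z).
Proof. by move=> z1; apply: is_derive_psum => //;
  exact: li_coef_subgeometric. Qed.

Lemma mul_dLreg w z : w != [::] -> `|z| < 1 ->
  z * dLreg w z = drop_last w z - drop_first w z.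
Proof.
move=> wn z1; rewrite /dLreg mul_psum_diffs //;
  last exact: li_coef_subgeometric.
under eq_fun do rewrite natr_li_coef //.
have hs : subgeometric (fun n => (head la w)%:R * li_coef (behead w) n).
  apply: subgeometric_le (li_coef_subgeometric (behead w)) => n.
  by rewrite normrM; case: (head la w); rewrite ?normr1 ?normr0 ?mul1r ?mul0r.
have hE : psum (fun n => (head la w)%:R * li_coef (behead w) n) z = drop_first
  w z.
  rewrite /drop_first; case: (head la w); last first.
    rewrite mul0r; apply: psumE; rewrite /pseries.
    rewrite (_ : series _ = fun=> 0); first exact: cvg_cst.
    by apply/funext => n; rewrite /series /= big1 // => i _; rewrite !mul0r.
  by rewrite mul1r; congr (psum _ z); apply/funext => n; rewrite mul1r.
rewrite /drop_last /zkernel; case: (last lb w).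
  by rewrite psumB // ?hE ?mul1r //; exact: li_coef_subgeometric.
rewrite psumB // ?hE; last exact: li_coef_sums_subgeometric.
rewrite psum_partial_sums //; [exact: li_coef_subgeometric|].
exact: li_coef_sums_subgeometric.
Qed.

Lemma shuffle_sum_cons (V : nmodType) (F : word -> V) u x v y :
  \sum_(w <- shuffle (x :: u) (y :: v)) F w =
  \sum_(w <- shuffle u (y :: v)) F (x :: w) +
  \sum_(w <- shuffle (x :: u) v) F (y :: w).
Proof. by rewrite /= big_cat !big_map. Qed.

Lemma shuffle_sum_rcons (V : nmodType) (F : word -> V) u x v y :
  \sum_(w <- shuffle (rcons u x) (rcons v y)) F w =
  \sum_(w <- shuffle u (rcons v y)) F (rcons w x) +
  \sum_(w <- shuffle (rcons u x) v) F (rcons w y).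
Proof.
have H (G : word -> V) p q : \sum_(w <- shuffle p q) G w =
    \sum_(w <- shuffle (rev p) (rev q)) G (rev w).
  by rewrite shuffle_sum_rev; apply: eq_bigr => w _; rewrite revK.
rewrite H !rev_rcons shuffle_sum_cons [X in _ = X + _]H [X in _ = _ + X]H.
by rewrite !rev_rcons; congr (_ + _); apply: eq_bigr => w _; rewrite rev_cons.
Qed.

Lemma is_derive_bigsum (I : eqType) (s : seq I) (f df : I -> R -> R) z :
  (forall i, is_derive z 1 (f i) (df i z)) ->
  is_derive z 1 (fun x => \sum_(i <- s) f i x) (\sum_(i <- s) df i z).
Proof.
move=> fd; elim: s => [|i s IH].
  rewrite big_nil (_ : (fun _ => _) = cst 0); first exact: is_derive_cst.
  by apply/funext => x; rewrite big_nil.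
rewrite big_cons.
rewrite (_ : (fun _ => _) = f i + (fun x => \sum_(i <- s) f i x)).
  exact: is_deriveD.
by apply/funext => x; rewrite big_cons.
Qed.

(** Both sides agree at 0, and their difference has derivative 0: removing the last letter, or a
    leading b, is a derivation for the shuffle product, so induction on the total length applies to
    the differential equation. *)
Lemma Lreg_shuffle u v z : 0 <= z < 1 ->
  \sum_(w <- shuffle u v) Lreg w z = Lreg u z * Lreg v z.
Proof.
have [n] := ubnP (size u + size v)%N; elim: n u v z => // n IH u v z.
have [->|un] := eqVneq u [::]; first by rewrite /= big_seq1 Lreg_nil mul1r.
have [->|vn] := eqVneq v [::].
  by rewrite Lreg_nil mulr1; case: (u) => *; rewrite big_seq1.
move=> le_n /andP[z0 z1].
pose f x := \sum_(w <- shuffle u v) Lreg w x - Lreg u x * Lreg v x.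
pose df x := \sum_(w <- shuffle u v) dLreg w x -
             (Lreg u x * dLreg v x + Lreg v x * dLreg u x).
have normx x : 0 <= x <= z -> `|x| < 1.
  by move=> /andP[x0 xz]; rewrite ger0_norm // (le_lt_trans xz).
have fd x : 0 <= x <= z -> is_derive x 1 f (df x).
  move=> /normx x1; apply: is_deriveB.
    by apply: (@is_derive_bigsum _ (shuffle u v) Lreg dLreg x) => w;
      exact: is_derive_Lreg.
  have := is_deriveM (is_derive_Lreg u x1) (is_derive_Lreg v x1).
  by [].
have nz_shuffle w : w \in shuffle u v -> w != [::].
  by move=> /shuffle_size; rewrite -!size_eq0 => ->;
    rewrite addn_eq0 size_eq0 (negPf un).
have lastS x : 0 <= x <= z -> \sum_(w <- shuffle u v) drop_last w x =
    drop_last u x * Lreg v x + Lreg u x * drop_last v x.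
  move=> /andP[x0 xz]; have x01 : 0 <= x < 1 by rewrite x0 (le_lt_trans xz).
  case/lastP: u un le_n {f df fd nz_shuffle} => // u a _.
  case/lastP: v vn => // v b _; rewrite !size_rcons => le_n.
  rewrite shuffle_sum_rcons /drop_last !last_rcons !belast_word_rcons.
  under eq_bigr do rewrite last_rcons belast_word_rcons.
  under [X in _ + X]eq_bigr do rewrite last_rcons belast_word_rcons.
  rewrite -!mulr_sumr !IH ?size_rcons //; try lia.
  by ring.
have firstS x : 0 <= x <= z -> \sum_(w <- shuffle u v) drop_first w x =
    drop_first u x * Lreg v x + Lreg u x * drop_first v x.
  move=> /andP[x0 xz]; have x01 : 0 <= x < 1 by rewrite x0 (le_lt_trans xz).
  case: u un le_n {f df fd nz_shuffle lastS} => // a u _.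
  case: v vn => // b v _ le_n.
  have n1 : (size u + size (b :: v) < n)%N by move: le_n => /=; lia.
  have n2 : (size (a :: u) + size v < n)%N by move: le_n => /=; lia.
  rewrite shuffle_sum_cons !drop_first_cons.
  under eq_bigr do rewrite drop_first_cons.
  under [X in _ + X]eq_bigr do rewrite drop_first_cons.
  rewrite -!mulr_sumr (IH _ _ _ n1) // (IH _ _ _ n2) //.
  by ring.
have df0 x : 0 < x < z -> df x = 0.
  move=> /andP[x0 xz]; have x0z : 0 <= x <= z by rewrite !ltW.
  have x1 := normx _ x0z; have xn0 : x != 0 by rewrite gt_eqF.
  apply: (mulfI xn0); rewrite mulr0 /df mulrBr mulr_sumr.
  rewrite big_seq; under eq_bigr => w win do rewrite mul_dLreg ?nz_shuffle //.
  rewrite -big_seq sumrB lastS // firstS //.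
  have -> : x * (Lreg u x * dLreg v x + Lreg v x * dLreg u x) =
    Lreg u x * (x * dLreg v x) + Lreg v x * (x * dLreg u x) by ring.
  by rewrite !mul_dLreg //; ring.
have : f 0 = f z.
  apply: derivative0_eq => // x x0z; first by have [] := fd _ x0z.
  have /fd : 0 <= x <= z by case/andP: x0z => x0 xz; rewrite !ltW.
  by rewrite df0.
rewrite {1}/f !Lreg0 (negPf un) mul0r subr0 big_seq big1.
  by move/esym/eqP; rewrite subr_eq0 => /eqP.
by move=> w /nz_shuffle/negPf wn; rewrite Lreg0 wn.
Qed.

Lemma Lreg_a z : 0 <= z < 1 -> Lreg [:: la] z = - ln (1 - z).
Proof.
move=> /andP[z0 z1].
pose f x := Lreg [:: la] x + ln (1 - x).
have fd x : 0 <= x <= z -> is_derive x 1 f (dLreg [:: la] x - (1 - x)^-1).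
  move=> /andP[x0 xz]; have x1 : `|x| < 1 by rewrite ger0_norm // (le_lt_trans
    xz).
  apply: is_deriveD; first exact: is_derive_Lreg.
  have x1' : 0 < 1 - x by rewrite subr_gt0 (le_lt_trans xz).
  have dg : is_derive x 1 ((cst 1 : R -> R) - id) (0 - 1) by exact: is_deriveB.
  have := @is_derive1_comp _ (@ln R) ((cst 1 : R -> R) - id) x _ _
    (is_derive1_ln x1') dg.
  by rewrite sub0r mulrN1.
have : f 0 = f z.
  apply: derivative0_eq => // x x0z; first by have [] := fd _ x0z.
  case/andP: x0z => x0 xz.
  have /fd : 0 <= x <= z by rewrite !ltW.
  have x1 : `|x| < 1 by rewrite gtr0_norm // (lt_trans xz).
  suff -> : dLreg [:: la] x = (1 - x)^-1 by rewrite subrr.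
  have xn0 : x != 0 by rewrite gt_eqF.
  apply: (mulfI xn0); rewrite mul_dLreg // /drop_last /drop_first /= mul0r
    subr0.
  by rewrite Lreg_nil mulr1.
rewrite /f Lreg0 /= subr0 ln1 addr0 => E.
by apply/eqP; rewrite -addr_eq0 -E.
Qed.

End Coefficients.

(** * Values at 1 as values at 1/2 *)

Section Duality.
Variable R : realType.
Implicit Types (u v w : word) (z e : R) (c : nat -> R).

Local Open Scope classical_set_scope.

Definition negrev w : word := map negb (rev w).

Lemma negrev_cons x w : negrev (x :: w) = rcons (negrev w) (~~ x).
Proof. by rewrite /negrev rev_cons map_rcons. Qed.

Lemma head_negrev w : head la (negrev w) = ~~ last lb w.
Proof.
by case/lastP: w => // w x; rewrite /negrev rev_rcons last_rcons.
Qed.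

Lemma head_take w i : head la w = la -> head la (take i w) = la.
Proof. by case: w i => [|x w] [|i]. Qed.

Lemma last_drop w i : last lb w = lb -> last lb (drop i w) = lb.
Proof.
rewrite -{1}[w](cat_take_drop i) last_cat.
by case: (drop i w).
Qed.

Lemma psum_le c z B : subgeometric c -> `|z| < 1 ->
  (forall k, \sum_(i < k) c i * z ^+ i <= B) -> psum c z <= B.
Proof.
move=> cs z1 cB; have cv := pseries_cvg cs z1.
rewrite /psum; apply: limr_le; first exact: cvgP cv.
by apply: nearW => k; rewrite /pseries /series /= big_mkord.
Qed.

Lemma psum_ge c z k : subgeometric c -> `|z| < 1 -> 0 <= z ->
  (forall n, 0 <= c n) -> \sum_(i < k) c i * z ^+ i <= psum c z.
Proof.
move=> cs z1 z0 c0; have cv := pseries_cvg cs z1.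
have := @nondecreasing_cvgn_le _ (pseries c z) _ (cvgP _ cv) k.
rewrite (cvg_lim _ cv) // /pseries /series /= big_mkord; apply.
apply/nondecreasing_seqP => n; rewrite /series /= big_nat_recr //= lerDl.
by rewrite mulr_ge0 // exprn_ge0.
Qed.

Lemma unit_interval_subgeometric c : (forall n, 0 <= c n <= 1) -> subgeometric
  c.
Proof.
move=> c01; apply: (@bounded_subgeometric _ _ 1) => n.
by have /andP[c0 c1] := c01 n; rewrite ger0_norm.
Qed.

Lemma psum_le_geometric c z : (forall n, 0 <= c n <= 1) -> c 0%N = 0 ->
  0 <= z < 1 -> psum c z <= z / (1 - z).
Proof.
move=> c01 c0 z01; have /andP[z0 z1] := z01.
apply: psum_le => [||[|k]].
- exact: unit_interval_subgeometric.
- by rewrite ger0_norm.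
- by rewrite big_ord0 divr_ge0 // subr_ge0 ltW.
rewrite big_ord_recl c0 mul0r add0r.
apply: le_trans (ler_wpM2l z0 (sum_geometric_le k z01)).
rewrite mulr_sumr; apply: ler_sum => i _; rewrite -exprS /= /bump add1n.
by rewrite ler_piMl ?exprn_ge0 //; have /andP[] := c01 i.+1.
Qed.

(** Abelian estimate: the terms below N, where [c] may exceed e, add up to at most N, and the others
    to at most e / (1 - z). *)
Lemma psum_cvg0_le c e : (forall n, 0 <= c n <= 1) -> c @ \oo --> 0 -> 0 < e ->
  exists N : nat, forall z, 0 <= z < 1 -> (1 - z) * psum c z <= e + (1 - z) *
    N%:R.
Proof.
move=> c01 /cvgrPdist_le /(_ e) cv e0; have [//|N _ cN] := cv.
exists N => z z01; have /andP[z0 z1] := z01; have z1' : 0 < 1 - z by lra.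
rewrite -ler_pdivlMl // mulrDr mulKf ?gt_eqF // mulrC.
apply: psum_le => [||k].
- exact: unit_interval_subgeometric.
- by rewrite ger0_norm.
apply: (@le_trans _ _ (\sum_(i < k) (e * z ^+ i + (i < N)%:R))).
  apply: ler_sum => i _; have /andP[c0 c1] := c01 i.
  have zi0 : 0 <= z ^+ i by rewrite exprn_ge0.
  have zi1 : z ^+ i <= 1 by rewrite exprn_ile1 // ltW.
  case: ltnP => iN /=.
    rewrite -[leLHS]add0r; apply: lerD; first by rewrite mulr_ge0 // ltW.
    by rewrite mulr_ile1.
  rewrite addr0 ler_wpM2r //; have := cN i iN.
  by rewrite /= sub0r normrN ger0_norm.
rewrite big_split -mulr_sumr; apply: lerD.
  by rewrite ler_wpM2l ?sum_geometric_le // ltW.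
rewrite -natr_sum ler_nat.
have -> : (\sum_(i < k) (i < N))%N = minn k N; last exact: geq_minr.
elim: k => [|k IH]; first by rewrite big_ord0 min0n.
by rewrite big_ord_recr IH /=; case: (ltnP k N) => kN /=; lia.
Qed.

Lemma li_coef_plus w n : w != [::] -> head la w = la ->
  li_coef R w n = n%:R^-1 *
    (if last lb w then li_coef R (belast_word w) n
     else \sum_(m < n) li_coef R (belast_word w) m).
Proof. by move=> wn hw; rewrite li_coefE // hw mul0r subr0. Qed.

Lemma plus_word_ind (P : word -> Prop) : P [::] ->
  (forall w, w != [::] -> head la w = la -> P (belast_word w) -> P w) ->
  forall w, head la w = la -> P w.
Proof.
move=> P0 PS; elim/last_ind => // w x IH hx.
have hw : head la w = la by case: (w) hx.
by apply: PS => //; [case: (w) | rewrite belast_word_rcons; exact: IH].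
Qed.

Lemma li_coef_unit w n : head la w = la -> 0 <= li_coef R w n <= 1.
Proof.
move=> hw; move: w hw n; apply: plus_word_ind => [n|w wn hw IH [|n]].
- by rewrite li_coef_nil; case: eqP; rewrite /= ?lexx ler01.
- by rewrite li_coef0 (negPf wn) lexx ler01.
rewrite li_coef_plus //.
set A := (if _ then _ else _).
suff /andP[A0 A1] : 0 <= A <= n.+1%:R.
  by rewrite mulr_ge0 //= ler_pdivrMl ?ltr0n // mulr1.
rewrite /A; case: ifP => _.
  have /andP[i0 i1] := IH n.+1; rewrite i0 (le_trans i1) //.
  by rewrite ler1n.
rewrite sumr_ge0 /=; last by move=> i _; have /andP[] := IH i.
rewrite -[n.+1 in leRHS]card_ord -sumr_const.
by apply: ler_sum => i _; have /andP[] := IH i.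
Qed.

(** A final a replaces the coefficients by their Cesaro means, a final b divides them by n; both
    preserve the limit 0. *)
Lemma li_coef_cvg0 w : head la w = la -> li_coef R w @ \oo --> 0.
Proof.
move: w; apply: plus_word_ind => [|w wn hw IH].
  by rewrite -cvg_shiftS; exact: cvg_cst.
rewrite -cvg_shiftS.
have [lw|lw] := boolP (last lb w); last first.
  rewrite (_ : [sequence _]_n = arithmetic_mean (li_coef R (belast_word w))).
    exact: cesaro.
  apply/funext => n; rewrite /= li_coef_plus // (negPf lw).
  by rewrite /arithmetic_mean /series /= big_mkord.
have hb : head la (belast_word w) = la by exact: head_take.
apply: (@squeeze_cvgr _ _ _ _ (cst 0) (fun n => li_coef R (belast_word w)
  n.+1)).
- apply: nearW => n; have /andP[i0 i1] := li_coef_unit n.+1 hb.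
  rewrite /= li_coef_plus // lw mulr_ge0 ?invr_ge0 //=.
  by rewrite ler_piMl // invf_le1 ?ltr0n // ler1n.
- exact: cvg_cst.
- by rewrite (cvg_shiftS (li_coef R (belast_word w))).
Qed.

Lemma Lreg_ge0 w z : head la w = la -> 0 <= z < 1 -> 0 <= Lreg w z.
Proof.
move=> hw /andP[z0 z1].
have := @psum_ge (li_coef R w) z 0 (@li_coef_subgeometric _ w).
rewrite big_ord0 ger0_norm //; apply => // n.
by have /andP[] := li_coef_unit n hw.
Qed.

Lemma Lreg_le w z : w != [::] -> head la w = la -> 0 <= z < 1 ->
  Lreg w z <= z / (1 - z).
Proof.
move=> wn hw z01; apply: psum_le_geometric => // [n|];
  first exact: li_coef_unit.
by rewrite li_coef0 (negPf wn).
Qed.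

Lemma dLreg_nil z : `|z| < 1 -> dLreg [::] z = 0.
Proof.
move=> z1; have := is_derive_Lreg [::] z1.
rewrite (_ : Lreg [::] = cst 1); last by apply/funext => x; rewrite Lreg_nil.
move=> d1; have d2 : is_derive z 1 (cst 1 : R -> R) 0 by exact: is_derive_cst.
by rewrite -(@derive_val _ _ _ _ _ _ _ d1) (@derive_val _ _ _ _ _ _ _ d2).
Qed.

Lemma dLreg_rcons u x z : head la (rcons u x) = la -> 0 < z < 1 ->
  dLreg (rcons u x) z = (if x then z else 1 - z)^-1 * Lreg u z.
Proof.
move=> hu /andP[z0 z1]; have zn0 : z != 0 by rewrite gt_eqF.
have z1n : 1 - z != 0 by rewrite gt_eqF // subr_gt0.
apply: (mulfI zn0); rewrite mul_dLreg ?gtr0_norm //; last by case: (u).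
rewrite /drop_first hu mul0r subr0 /drop_last last_rcons belast_word_rcons.
by rewrite /zkernel mulrA; case: x {hu}; rewrite ?divff.
Qed.

(** The coordinate at w of y(z) sigma(y(1 - z)), with y the generating series of [Lreg]. For w in
    W^{++} the prefixes and the reversed suffixes lie in W^+, so no logarithm is missing. *)
Definition Lreg_dual w z : R := deconcat (fun u v => Lreg u z * Lreg (negrev v)
  (1 - z)) w.

(** Differentiating the prefix drops its last letter; differentiating the suffix factor drops the
    first letter of the suffix, with the same kernel and the opposite sign, as 1 - z and the
    exchange of letters both swap the two kernels. *)
Lemma is_derive_Lreg_dual w z : head la w = la -> last lb w = lb -> 0 < z < 1 ->
  is_derive z 1 (Lreg_dual w) 0.
Proof.
move=> hw lw /andP[z0 z1]; have nz : `|z| < 1 by rewrite gtr0_norm.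
have z1' : 0 < 1 - z < 1 by lra.
have n1z : `|1 - z| < 1 by case/andP: z1' => *; rewrite gtr0_norm.
pose a i z := Lreg (take i w) z; pose b i z := Lreg (negrev (drop i w)) (1 - z).
pose da i := dLreg (take i w) z; pose db i := - dLreg (negrev (drop i w)) (1 -
  z).
have abd (i : 'I_(size w).+1) : is_derive z 1 (a i * b i) (a i z * db i + b i z
  * da i).
  apply: is_deriveM; first exact: is_derive_Lreg.
  have dg : is_derive z 1 ((cst 1 : R -> R) - id) (0 - 1) by exact: is_deriveB.
  have := @is_derive1_comp _ (@Lreg R (negrev (drop i w))) ((cst 1 : R -> R) -
    id) z _ _
    (is_derive_Lreg _ n1z) dg.
  by rewrite sub0r mulrN1.
rewrite (_ : Lreg_dual w = \sum_(i < (size w).+1) (a i * b i)); last first.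
  by apply/funext => x; rewrite fct_sumE.
rewrite [X in is_derive _ _ _ X](_ : 0 = \sum_(i < (size w).+1) (a i z * db i +
  b i z * da i)).
  exact: is_derive_sum.
(* Shifting one sum by one pairs the two terms that concern the same letter; the two boundary terms
   are derivatives for the empty word. *)
rewrite big_split big_ord_recr [X in _ = _ + X]big_ord_recl /=.
have -> : db (size w) = 0 by rewrite /db drop_size dLreg_nil ?oppr0.
have -> : da 0%N = 0 by rewrite /da take0 dLreg_nil.
rewrite !mulr0 addr0 add0r -big_split big1 //= => i _.
have iw := ltn_ord i; rewrite /bump add1n.
pose k : R := (if nth la w i then z else 1 - z)^-1.
have -> : da i.+1 = k * a i z.
  rewrite /da (take_nth la iw) dLreg_rcons ?z0 //.
  by rewrite -(take_nth la iw); exact: head_take.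
have -> : db i = - (k * b i.+1 z).
  rewrite /db (drop_nth la iw) negrev_cons dLreg_rcons //; last first.
    by rewrite -negrev_cons -(drop_nth la iw) head_negrev last_drop.
  by rewrite /k /b; case: (nth _ _ _); rewrite //= opprB addrC subrK.
by ring.
Qed.

Lemma Lreg_dual_const w y z : head la w = la -> last lb w = lb ->
  0 < y < 1 -> 0 < z < 1 -> Lreg_dual w y = Lreg_dual w z.
Proof.
move=> hw lw; wlog yz : y z / y <= z.
  by move=> H y01 z01; case: (leP y z) => [|/ltW] yz; [|apply/esym]; exact: H.
move=> /andP[y0 y1] /andP[z0 z1]; apply: derivative0_eq => // x /andP[yx xz].
  have x01 : 0 < x < 1 by lra.
  by have [] := is_derive_Lreg_dual hw lw x01.
by apply: is_derive_Lreg_dual => //; lra.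
Qed.

Lemma Lreg_sum_small (s : seq word) e : all (fun u => ~~ head la u) s -> 0 < e
  ->
  exists N : nat, forall z, 0 <= z < 1 ->
    \sum_(u <- s) (1 - z) * Lreg u z <= e + (1 - z) * N%:R.
Proof.
elim: s e => [|u s IH] e /=.
  move=> _ e0; exists 0%N => z _; rewrite big_nil mulr0 addr0; exact: ltW.
move=> /andP[/negbTE hu hs] e0; have e2 : 0 < e / 2 by lra.
have [N HN] := IH _ hs e2.
have [M HM] := psum_cvg0_le (fun n => li_coef_unit n hu) (li_coef_cvg0 hu) e2.
exists (M + N)%N => z z01; rewrite big_cons natrD mulrDr.
have := HN z z01; have := HM z z01; rewrite -/(Lreg u z); lra.
Qed.

Lemma Lreg_le_dual w z : head la w = la -> last lb w = lb -> 0 < z < 1 ->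
  Lreg w z <= Lreg_dual w z.
Proof.
move=> hw lw /andP[z0 z1].
rewrite /Lreg_dual /deconcat big_ord_recr /= take_size drop_size Lreg_nil mulr1.
rewrite lerDr; apply: sumr_ge0 => i _; apply: mulr_ge0.
  by apply: Lreg_ge0; [exact: head_take | lra].
by apply: Lreg_ge0; [rewrite head_negrev last_drop | lra].
Qed.

(** By constancy z may be moved to 1 - d, where the truncated power series is at most [Lreg], hence
    at most [Lreg_dual]. Replacing the powers of 1 - d by 1 costs at most N^2 d. *)
Lemma sum_li_coef_le w (N : nat) z : head la w = la -> last lb w = lb -> 0 < z
  < 1 ->
  \sum_(i < N) li_coef R w i <= Lreg_dual w z.
Proof.
move=> hw lw z01; apply/ler_addgt0Pr => e e0.
pose M : R := N%:R * N%:R + 1; have M0 : 0 < M by rewrite ltr_wpDl // mulr_ge0.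
pose d := Num.min 2^-1 (e / M).
have d0 : 0 < d by rewrite lt_min divr_gt0 // invr_gt0 ltr0n.
have d2 : d <= 2^-1 by rewrite ge_min lexx.
have dM : d * M <= e by rewrite -ler_pdivlMr // ge_min lexx orbT.
have x01 : 0 < 1 - d < 1 by lra.
rewrite (Lreg_dual_const hw lw z01 x01).
have x1 : `|1 - d| < 1 by case/andP: x01 => *; rewrite gtr0_norm.
have cs := @li_coef_subgeometric R w.
have H : \sum_(i < N) li_coef R w i * (1 - d) ^+ i <= Lreg_dual w (1 - d).
  apply: le_trans (Lreg_le_dual hw lw x01).
  apply: psum_ge => //; first by case/andP: x01 => *; exact: ltW.
  by move=> n; have /andP[] := li_coef_unit n hw.
rewrite -lerBlDl; apply: le_trans (lerB (lexx _) H) _.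
rewrite -sumrB; apply: (@le_trans _ _ (\sum_(i < N) N%:R * d)); last first.
  rewrite sumr_const card_ord -[leLHS]mulr_natl; apply: le_trans dM.
  rewrite mulrA mulrC ler_pM2l // /M lerDl; exact: ler01.
apply: ler_sum => i _; have /andP[c0 c1] := li_coef_unit i hw.
have xi : 1 - (1 - d) ^+ i <= i%:R * d.
  have -> : 1 - (1 - d) ^+ i = (\sum_(j < i) (1 - d) ^+ j) * d.
    by rewrite -opprB subrX1; ring.
  rewrite ler_pM2r // -[nat_of_ord i in leRHS]card_ord -sumr_const;
    apply: ler_sum => j _.
  by rewrite exprn_ile1 //; case/andP: x01 => ? ?; rewrite ltW.
have xi0 : 0 <= 1 - (1 - d) ^+ i.
  by rewrite subr_ge0 exprn_ile1 //; case/andP: x01 => ? ?; rewrite ltW.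
rewrite -[X in X - _]mulr1 -mulrBr.
apply: le_trans (_ : 1 * (1 - (1 - d) ^+ i) <= _); first by rewrite ler_wpM2r.
rewrite mul1r (le_trans xi) // ler_pM2r // ler_nat; exact/ltnW/ltn_ord.
Qed.

(** Boundedness comes from [sum_li_coef_le]. For the converse inequality, evaluate at 1 - d: the
    term with empty suffix is at most the sum of the series; in the others the suffix factor is at
    most 2 d, and d times the prefix factor is small. *)
Lemma series_li_coef_cvg w z : head la w = la -> last lb w = lb -> 0 < z < 1 ->
  series (li_coef R w) @ \oo --> Lreg_dual w z.
Proof.
move=> hw lw z01; set G := Lreg_dual w z.
have nd : nondecreasing_seq (series (li_coef R w)).
  apply/nondecreasing_seqP => n; rewrite /series /= big_nat_recr //= lerDl.
  by have /andP[] := li_coef_unit n hw.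
have cv : cvgn (series (li_coef R w)).
  apply: nondecreasing_is_cvgn => //; exists G => _ [n _ <-].
  by rewrite /series /= big_mkord; exact: sum_li_coef_le.
have sl k : \sum_(i < k) li_coef R w i <= limn (series (li_coef R w)).
  by have := nondecreasing_cvgn_le nd cv k; rewrite /series /= big_mkord.
suff <- : limn (series (li_coef R w)) = G by [].
apply/eqP; rewrite eq_le; apply/andP; split.
  apply: limr_le => //; apply: nearW => n.
  by rewrite /series /= big_mkord; exact: sum_li_coef_le.
apply/ler_addgt0Pr => e e0; set s := limn _ in sl *.
pose us := [seq take i w | i <- iota 0 (size w)].
have hus : all (fun u => ~~ head la u) us.
  by apply/allP => _ /mapP[i _ ->]; rewrite head_take.
have e4 : 0 < e / 4 by lra.
have [N HN] := Lreg_sum_small hus e4.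
(* The remaining terms add up to at most 2 (e/4 + d N), and d <= e/M makes 2 d N at most e/2. *)
pose M : R := 4 * (N%:R + 1); have M0 : 0 < M by rewrite mulr_gt0 // ltr_wpDl.
pose d := Num.min 2^-1 (e / M).
have d0 : 0 < d by rewrite lt_min divr_gt0 // invr_gt0 ltr0n.
have d2 : d <= 2^-1 by rewrite ge_min lexx.
have dM : d * M <= e by rewrite -ler_pdivlMr // ge_min lexx orbT.
have x01 : 0 < 1 - d < 1 by lra.
have x01' : 0 <= 1 - d < 1 by lra.
rewrite /G (Lreg_dual_const hw lw z01 x01).
rewrite /Lreg_dual /deconcat big_ord_recr /= take_size drop_size Lreg_nil mulr1
  addrC.
apply: lerD.
  apply: psum_le => [||k].
  - exact: li_coef_subgeometric.
  - by case/andP: x01 => *; rewrite gtr0_norm.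
  apply: le_trans (sl k); apply: ler_sum => i _.
  rewrite ler_piMr //; first by have /andP[] := li_coef_unit i hw.
  by rewrite exprn_ile1 //; case/andP: x01 => ? ?; rewrite ltW.
have := HN _ x01'; rewrite /us big_map -{1}[size w]subn0 -/(index_iota 0 (size
  w)) big_mkord => HN'.
have E1 : 1 - (1 - d) = d by rewrite opprB addrC subrK.
apply: (@le_trans _ _ (2 * (e / 4 + d * N%:R))); last first.
  move: dM; rewrite /M; nra.
rewrite E1 in HN'; apply: le_trans (ler_wpM2l _ HN') => //.
rewrite mulr_sumr; apply: ler_sum => i _; rewrite E1.
have iw := ltn_ord i.
have : Lreg (negrev (drop i w)) d <= d / (1 - d).
  apply: Lreg_le; last by lra.
    by rewrite (drop_nth la iw) negrev_cons; case: (negrev _).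
  by rewrite head_negrev last_drop.
have dd : d / (1 - d) <= 2 * d.
  by rewrite ler_pdivrMr; [nra | lra].
have L0 := Lreg_ge0 (head_take i hw) x01'.
move=> /le_trans /(_ dd) /(ler_wpM2l L0); lra.
Qed.

End Duality.

(** * Multiple sums *)

Section MultiSum.
Variable R : realType.

Local Open Scope complex_scope.

Lemma big_tuple_rcons (T : finType) (V : nmodType) k (F : k.+1.-tuple T -> V) :
  \sum_n F n = \sum_(n : k.-tuple T) \sum_x F [tuple of rcons n x].
Proof.
rewrite pair_big /=.
pose f (p : k.-tuple T * T) : k.+1.-tuple T := [tuple of rcons p.1 p.2].
rewrite (reindex f) //; apply: onW_bij; apply: inj_card_bij.
  move=> [p x] [q y] /(congr1 val) /= /rcons_inj [pq ->].
  by congr (_, _); apply: val_inj.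
by rewrite card_prod !card_tuple expnSr.
Qed.

Lemma li_coef_hword t s m : li_coef R (hword (rcons t s)) m =
  m%:R ^- s.+1 * \sum_(j < m) li_coef R (hword t) j.
Proof.
have hh : head la (hword (rcons t s)) = la by exact: head_hword.
elim: s hh => [|s IH] hh.
  rewrite hword_rcons cats1 /=; rewrite li_coef_plus ?last_rcons
    ?belast_word_rcons //.
    by case: (hword t).
  by rewrite -cats1 -[[:: la]]/(la :: nseq 0 lb) -hword_rcons head_hword.
have E : hword (rcons t s.+1) = rcons (hword (rcons t s)) lb.
  rewrite !hword_rcons rcons_cat; congr (_ ++ la :: _).
  by elim: (s) => //= k ->.
rewrite E li_coef_plus -?E //; last by rewrite E; case: (hword _).
rewrite E last_rcons belast_word_rcons IH ?head_hword //.
by rewrite mulrA -invfM -exprS.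
Qed.

(** The weight [phi] is arbitrary for the induction: peeling off the largest index x leaves a
    shorter sum weighted by the indicator of indices below x. *)
Lemma tuple_sum_li_coef (N k : nat) (t : seq nat) (phi : nat -> R[i]) :
  size t = k ->
  \sum_(n : k.-tuple 'I_N.+1 | path ltn 0%N [seq val i | i <- n])
    (\prod_(i < k) (val (tnth n i))%:R ^- (nth 0%N t i).+1) *
    phi (last 0%N [seq val i | i <- n]) =
  \sum_(m < N.+1) (li_coef R (hword t) m)%:C * phi m.
Proof.
elim: k t phi => [|k IH] t phi st.
  case: t st => // _; rewrite (big_pred1 [tuple]) => [|n];
    last by rewrite tuple0.
  rewrite big_ord0 mul1r /= big_ord_recl big1 ?addr0.
    by rewrite /= rmorph1 mul1r.
  by move=> i _; rewrite /= mul0r.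
case/lastP: t st => // t s; rewrite size_rcons => -[st].
rewrite big_mkcond big_tuple_rcons /=.
transitivity (\sum_(x < N.+1) (x%:R ^- s.+1 * phi x) *
    \sum_(n : k.-tuple 'I_N.+1 | path ltn 0%N [seq val i | i <- n])
      (\prod_(i < k) (val (tnth n i))%:R ^- (nth 0%N t i).+1) *
      (last 0%N [seq val i | i <- n] < x)%N%:R).
  under [RHS]eq_bigr do rewrite mulr_sumr big_mkcond.
  rewrite [RHS]exchange_big; apply: eq_bigr => n _; apply: eq_bigr => x _.
  rewrite map_rcons rcons_path last_rcons.
  case: ifP => [/andP[-> lx]|].
    have {}lx : (last 0%N [seq val i | i <- n] < x)%N by exact: lx.
    rewrite lx mulr1 big_ord_recr /= (tnth_nth x) /= nth_rcons size_tuple ltnn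
      eqxx.
    rewrite nth_rcons st ltnn eqxx.
    set P := \prod_(i < k) _; set Q := \prod_(i < k) _.
    suff -> : P = Q by ring.
    apply: eq_bigr => i _; rewrite !(tnth_nth x) /= !nth_rcons size_tuple
      ltn_ord.
    by rewrite st ltn_ord.
  case: path => //= lx.
  have {}lx : (last 0%N [seq val i | i <- n] < x)%N = false by exact: lx.
  by rewrite lx !mulr0.
apply: eq_bigr => x _; rewrite (IH t (fun l => (l < x)%N%:R)) //.
rewrite li_coef_hword rmorphM fmorphV rmorphXn rmorph_nat -!mulrA;
  congr (_ * _).
rewrite mulrC; congr (_ * _); rewrite rmorph_sum /=.
rewrite (big_ord_widen N.+1 (fun j => (li_coef R (hword t) j)%:C)) //;
  last exact/ltnW/ltn_ord.
rewrite [RHS]big_mkcond; apply: eq_bigr => i _.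
by case: ltnP; rewrite ?mulr1 ?mulr0.
Qed.

(** The successor matters: for empty [t] and bound 0 the left side would be 1 and the right side
    0. *)
Lemma multi_sum_li_coef t (z : R) N : multi_sum t (z%:C : R[i]) N.+1 =
  (series (fun n => li_coef R (hword t) n * z ^+ n) N.+1)%:C.
Proof.
rewrite /multi_sum (tuple_sum_li_coef _ (fun m => (z%:C) ^+ m)) // /series /=.
rewrite big_mkord rmorph_sum /=; apply: eq_bigr => i _.
by rewrite rmorphM rmorphXn.
Qed.

Local Open Scope classical_set_scope.

Let K : numFieldType := R[i].

Lemma cvg_real_complex (u : nat -> R) (l : R) :
  u @ \oo --> l -> (fun n => (u n)%:C : K) @ \oo --> (l%:C : K).
Proof.
move=> ul; apply/cvgrPdist_lt => e e0.
(* A positive element of R[i] is real. *)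
have er : e = (complex.Re e)%:C.
  by move: e0; rewrite ltcE /= => /andP[/eqP Im0 _]; case: e Im0 => a b /= ->.
have r0 : 0 < complex.Re e by move: e0; rewrite {1}er ltcR.
move/cvgrPdist_lt : ul => /(_ _ r0); apply: filterS => n h.
by rewrite -rmorphB /= normc_def /= expr0n /= addr0 sqrtr_sqr er ltcR.
Qed.

Lemma multi_series_li_coef t (z l : R) :
  series (fun n => li_coef R (hword t) n * z ^+ n) @ \oo --> l ->
  multi_series t (z%:C : R[i]) = l%:C.
Proof.
move=> ul; apply: cvg_lim; first exact: norm_hausdorff.
rewrite -cvg_shiftS.
rewrite (_ : [sequence _]_n = (fun n => (series (fun n => li_coef R (hword t) n
  * z ^+ n) n.+1)%:C)).
  by apply: cvg_real_complex; rewrite cvg_shiftS.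
by apply/funext => n; rewrite /= multi_sum_li_coef.
Qed.

End MultiSum.

(** * The points of Gamma given by polylogarithms at 1/2 and by polyzetas *)

Section Values.
Variable R : realType.

Local Open Scope complex_scope.

Lemma half_unit_interval : 0 <= (2^-1 : R) < 1.
Proof. by apply/andP; split; lra. Qed.

Lemma Lreg_half_shuffle u v : \sum_(w <- shuffle u v) (Lreg w 2^-1 : ratAlg R) =
  (Lreg u 2^-1 : ratAlg R) * (Lreg v 2^-1 : ratAlg R).
Proof. exact: (Lreg_shuffle u v half_unit_interval). Qed.

Definition Lreg_half : Gamma (ratAlg R) :=
  @mkGamma (ratAlg R) (fun w => Lreg w 2^-1) (Lreg_nil _) Lreg_half_shuffle.

(** The left factor, the exponential of log(1/2) beta, restores the logarithms removed from
    [Lreg_half]; it does not affect words of W^+. *)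
Definition L_half : Gamma (ratAlg R) :=
  (exp_point lb (ln (2^-1 : R) : ratAlg R) * Lreg_half)%g.

Definition zeta_point : Gamma (ratAlg R) := (L_half * sigma L_half)%g.

Definition coord (g : Gamma (ratAlg R)) (w : word) : R := g (wd w).
Arguments coord : simpl never.

Lemma coord_nil g : coord g [::] = 1.
Proof. by rewrite /coord wd_nil rmorph1. Qed.

Lemma coord_mul g h w : coord (g * h)%g w =
  \sum_(i < (size w).+1) coord g (take i w) * coord h (drop i w).
Proof. exact: (@Gamma_mulE (ratAlg R) g h w). Qed.

Lemma coord_sigma g w : coord (sigma g) w = coord g (negrev w).
Proof. exact: (@sigmaE (ratAlg R) g w). Qed.

Lemma coord_Lreg_half w : coord Lreg_half w = Lreg w 2^-1.
Proof.
by rewrite /coord /Lreg_half mkGammaE.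
Qed.

Lemma coord_exp_point x (t : R) w : coord (exp_point x (t : ratAlg R)) w =
  if w == nseq (size w) x then (size w)`!%:R^-1 * t ^+ size w else 0.
Proof.
rewrite /coord exp_pointE; case: ifP => // _.
by rewrite /GRing.scale /= /ratAlg_scale fmorphV rmorph_nat.
Qed.

Lemma L_half_plus w : head la w = la -> coord L_half w = Lreg w 2^-1.
Proof.
move=> hw; rewrite coord_mul big_ord_recl take0 drop0 coord_nil mul1r.
rewrite coord_Lreg_half big1 ?addr0 // => i _; rewrite coord_exp_point.
by case: w hw i => [|x w] /= hx i; [case: i | rewrite hx mul0r].
Qed.

Lemma L_half_b : coord L_half [:: lb] = ln (2^-1 : R).
Proof.
rewrite coord_mul big_ord_recl big_ord1 /= !coord_Lreg_half coord_exp_point /=.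
have -> : Lreg [:: lb] (2^-1 : R) = 0.
  apply: psumE; rewrite /pseries (_ : series _ = fun=> 0); first exact: cvg_cst.
  apply/funext => n; rewrite /series /= big1 // => i _.
  by rewrite li_coefE //= mul1r subrr mulr0 mul0r.
by rewrite coord_exp_point Lreg_nil mulr1 mulr0 add0r invr1 mul1r.
Qed.

Lemma L_half_a : coord L_half [:: la] = - ln (2^-1 : R).
Proof.
rewrite L_half_plus // Lreg_a ?half_unit_interval //; congr (- ln _); lra.
Qed.

Lemma sigma_zeta_point : sigma zeta_point = zeta_point.
Proof. by rewrite /zeta_point sigmaM sigmaK. Qed.

(** The coordinates of [L_half] at a and b are -log(1 - z) and log z at z = 1/2, hence opposite. *)
Lemma zeta_point_letter x : coord zeta_point [:: x] = 0.
Proof.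
rewrite coord_mul big_ord_recl big_ord1 /= !coord_nil mul1r mulr1 coord_sigma.
by case: x; rewrite /= L_half_a L_half_b ?addNr ?addrN.
Qed.

Lemma zeta_point_admissible w : head la w = la -> last lb w = lb ->
  coord zeta_point w = Lreg_dual w (2^-1 : R).
Proof.
move=> hw lw; rewrite coord_mul; apply: eq_bigr => i _.
rewrite coord_sigma !L_half_plus ?head_take //.
  by congr (_ * Lreg _ _); lra.
by rewrite head_negrev last_drop.
Qed.

Definition complex_point (g : Gamma (ratAlg R)) : {rmorphism shalg -> R[i]} :=
  real_complex R \o (g : shalg -> R).

Lemma complex_point_wd g w : complex_point g (wd w) = (coord g w)%:C.
Proof. by []. Qed.

Lemma half_real : (2^-1 : R[i]) = (2^-1 : R)%:C.
Proof. by rewrite fmorphV rmorph_nat. Qed.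

Lemma logC_real (x : R) : 0 < x -> logC x%:C = (ln x)%:C.
Proof.
move=> x0; rewrite /logC /= expr0n addr0 sqrtr_sqr gtr0_norm // divff ?gt_eqF
  //.
by rewrite acos1 lexx.
Qed.

Lemma is_polylog_L_half : is_polylog (2^-1 : R[i]) (complex_point L_half).
Proof.
split=> [t|]; rewrite half_real complex_point_wd.
  rewrite L_half_plus ?head_hword //; apply/esym/multi_series_li_coef.
  apply: pseries_cvg; first exact: li_coef_subgeometric.
  by rewrite ger0_norm; have /andP[] := half_unit_interval.
by rewrite L_half_b logC_real.
Qed.

Lemma is_polyzeta_zeta_point : is_polyzeta (complex_point zeta_point).
Proof.
split=> [t lt||]; rewrite complex_point_wd ?zeta_point_letter //.
have lw : last lb (hword t) = lb by rewrite last_hword.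
rewrite zeta_point_admissible ?head_hword //.
apply/esym/(@multi_series_li_coef R t 1).
under eq_fun do rewrite expr1n mulr1.
by apply: series_li_coef_cvg => //; [exact: head_hword | lra].
Qed.

Lemma polylog_half h : polylog h (2^-1 : R[i]) = complex_point L_half h.
Proof.
apply: xget_unique; first by exists (complex_point L_half);
  first exact: is_polylog_L_half.
move=> _ [L [Lt Lb] ->]; have [Ht Hb] := is_polylog_L_half.
apply: polylog_unique => [t|].
  by rewrite Lt Ht.
by rewrite Lb Hb.
Qed.

Lemma polyzeta_zeta_point h : polyzeta R h = complex_point zeta_point h.
Proof.
apply: xget_unique; first by exists (complex_point zeta_point);
  first exact: is_polyzeta_zeta_point.
move=> _ [Z [Zt Za Zb] ->]; have [Ht Ha Hb] := is_polyzeta_zeta_point.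
apply: polyzeta_unique => [t lt||].
- by rewrite Zt ?Ht.
- by rewrite Za Ha.
- by rewrite Zb Hb.
Qed.

End Values.

Theorem mainTheorem1 (R : realType) (phi : regP) :
  polyzetaP R phi = polylogP (square phi) (2^-1 : R[i]).
Proof.
have [f fP] := regP_regular phi.
have ef : extends f phi by move=> A p; rewrite fP.
(* Being fixed by [sigma], [zeta_point] is a point of P, so all extensions of [phi] agree there. *)
have Zphi f' : extends f' phi -> zeta_point R f' = zeta_point R f.
  by move=> ef'; rewrite -[zeta_point R]/(symP_val (SymP (sigma_zeta_point R)))
    ef' ef.
transitivity (real_complex R (zeta_point R f)).
  apply: xget_unique; first by exists f; rewrite ?polyzeta_zeta_point.
  by move=> _ [f' ef' ->]; rewrite polyzeta_zeta_point -(Zphi f' ef').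
have L f2 : extends f2 (square phi) -> right_K_invariant f2 ->
    polylog f2 (2^-1 : R[i]) = real_complex R (zeta_point R f).
  move=> e2 k2; rewrite polylog_half; congr (real_complex R _).
  exact: (@square_extension_eval phi f f2 (ratAlg R) (L_half R) ef e2 k2).
have [e2 k2] := square_right_K_invariant_extension ef.
apply/esym; apply: xget_unique; first by exists (coproduct_sigma f); rewrite ?L.
by move=> _ [f2 [e2' k2'] ->]; rewrite L.
Qed.
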